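(* Let $d\in\mathbb N^+$, $\lambda>0$ and $\alpha=\lambda=\mu$. If $0<t<1/\lambda$, the integral equation satisfied by the emptiness probability $p(0,t)$ of the process $\mathcal N$ (defined in the context), namely $$p(0,t)=\frac{1}{1+\lambda t}-\lambda(d-1)\int_0^t\frac{p(0,y)}{[1+\lambda(t-y)]^2}\,dy,$$ admits the following solution: $$p(0,t)=1+\sum_{n=1}^{+\infty}\frac{(-\lambda t)^n}{n!}\sum_{j=1}^n t_{n,j}\,d^j,$$ where $t_{n,j}$ is the number of permutations of $\{1,\ldots,n\}$ with $j$ components.
   Context: Let $D=\{1,\ldots,d\}$. $\mathcal N=\{(N(t),J(t)),t\ge 0\}$ is the (nonexplosive) continuous-time Markov chain on $S=\{(0,0)\}\cup(\mathbb N^+\times D)$ whose only nonzero off-diagonal transition rates are, for $k\in\mathbb N^+$ and $j\in D$: from $(0,0)$ to $(1,j)$ at rate $\alpha$; from $(k,j)$ to $(k+1,j)$ at rate $\alpha+\lambda k$; from $(k,j)$ to $(k-1,j)$ at rate $\mu k$, where $(0,j)$ is identified with $(0,0)$ for every $j$. The initial state is $0:=(0,0)$, and $p(0,t)=\mathbb P\{(N(t),J(t))=0\mid (N(0),J(0))=0\}$. A permutation is indecomposable if its one-line notation cannot be split into two (nonempty) parts such that every number in the first part is smaller than every number in the second part; the number of components of a permutation is the number of blocks in its finest splitting into consecutive parts such that every number in an earlier part is smaller than every number in a later part. The numbers $t_{n,k}$ ($n\ge1$, $k\ge 1$; $t_{n,k}=0$ if $n<k$) satisfy $t_{n,1}=n!-\sum_{j=1}^{n-1}(n-j)!\,t_{j,1}$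 and $t_{n,k}=\sum_{j=1}^{n-k+1}t_{j,1}\,t_{n-j,k-1}$ for $2\le k\le n$. *)

(* Defs.v *)
From mathcomp Require Import all_boot all_order all_algebra all_fingroup.
From mathcomp Require Import all_classical all_reals all_analysis.

Set Implicit Arguments.
Unset Strict Implicit.
Unset Printing Implicit Defensive.

Import Order.TTheory GRing.Theory Num.Theory.
Import numFieldNormedType.Exports.

Local Open Scope classical_set_scope.
Local Open Scope ring_scope.

(* [q x y] is the rate of the transition from [x] to [y] for [x != y]; the
   diagonal values of [q] are never used. The chain is conservative (the rate
   of leaving [x] is the sum of the rates to the other states) and nonexplosive
   (the rows of [p t] sum to 1). *)
Record transition_function (R : realType) (S : countType) (q : S -> S -> R)
    (p : R -> S -> S -> R) : Prop := TransitionFunction {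
  tf_ge0 : forall t x y, 0 <= t -> 0 <= p t x y ;
  tf_sum1 : forall t x, 0 <= t ->
    (\esum_(y in [set: S]) (p t x y)%:E = 1)%E ;
  tf_time0 : forall x y, p 0 x y = (x == y)%:R ;
  tf_Chapman_Kolmogorov : forall s t x z, 0 <= s -> 0 <= t ->
    ((p (s + t) x z)%:E = \esum_(y in [set: S]) (p s x y * p t y z)%:E)%E ;
  tf_jump_rate : forall x y, x != y -> (p h x y / h) @[h --> 0^'+] --> q x y ;
  tf_exit_rate : forall x,
    ((1 - p h x x) / h)%:E @[h --> 0^'+]
      --> (\esum_(y in [set y | y != x]) (q x y)%:E)%E
}.

(* The process is indexed by the times [t >= 0]; the values of [X t] for
   [t < 0] are irrelevant. *)
Definition Markov_property (R : realType) (dO : measure_display)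
    (Omega : measurableType dO) (P : probability Omega R) (S : countType)
    (X : R -> Omega -> S) (p : R -> S -> S -> R) : Prop :=
  forall (n : nat) (s : nat -> R) (x : nat -> S),
    0 <= s 0%N -> (forall i, (i <= n)%N -> s i < s i.+1) ->
    P [set w | forall i, (i <= n.+1)%N -> X (s i) w = x i] =
    (P [set w | forall i, (i <= n)%N -> X (s i) w = x i]
       * (p (s n.+1 - s n)%R (x n) (x n.+1))%:E)%E.

Definition CTMC (R : realType) (dO : measure_display)
    (Omega : measurableType dO) (P : probability Omega R) (S : countType)
    (q : S -> S -> R) (X : R -> Omega -> S) : Prop :=
  (forall t x, 0 <= t -> measurable [set w | X t w = x]) /\
  (exists2 p, transition_function q p & Markov_property P X p).

Definition cond_prob (R : realType) (dO : measure_display)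
    (Omega : measurableType dO) (P : probability Omega R)
    (A B : set Omega) : R :=
  fine (P (A `&` B)) / fine (P B).

Definition in_state (d : nat) (x : nat * nat) : bool :=
  (x == (0, 0)%N) || ((0 < x.1)%N && (1 <= x.2 <= d)%N).

Definition state (d : nat) : Type := {x : nat * nat | in_state d x}.

Definition empty_state (d : nat) : state d :=
  exist (fun x => in_state d x) (0, 0)%N isT.

Definition ident0 (k j : nat) : nat * nat :=
  if k == 0%N then (0, 0)%N else (k, j).

Definition NJ_rate (R : realType) (d : nat) (alpha lambda mu : R)
    (x y : state d) : R :=
  let: (k, j) := val x in
  if k == 0%N then (if (val y).1 == 1%N then alpha else 0)
  else if val y == (k.+1, j) then alpha + lambda * k%:R
  else if val y == ident0 k.-1 j then mu * k%:R
  else 0.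

Definition emptiness_prob (R : realType) (dO : measure_display)
    (Omega : measurableType dO) (P : probability Omega R) (d : nat)
    (X : R -> Omega -> state d) (t : R) : R :=
  cond_prob P [set w | X t w = empty_state d] [set w | X 0 w = empty_state d].

(* Parts of the one-line notation of [s] are given by their sets of positions. *)
Definition splitting (n : nat) (s : 'S_n) (Q : {set {set 'I_n}}) : bool :=
  [&& finset.partition Q finset.setT,
      [forall A in Q, forall i in A, forall k in A, forall j : 'I_n,
         (i < j < k)%N ==> (j \in A)] &
      [forall A in Q, forall B in Q, (A != B) ==>
         [forall i in A, forall j in B, (i < j)%N ==> (s i < s j)%N]]].

Definition finest_splitting (n : nat) (s : 'S_n) (Q : {set {set 'I_n}}) :
    bool :=
  splitting s Q &&
  [forall Q' : {set {set 'I_n}}, splitting s Q' ==>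
     [forall A in Q, exists B in Q', A \subset B]].

Definition has_components (n : nat) (s : 'S_n) (k : nat) : bool :=
  [exists Q : {set {set 'I_n}}, finest_splitting s Q && (#|Q| == k)].

Definition num_perm_components (n k : nat) : nat :=
  #|[pred s : 'S_n | has_components s k]|.

(* Main.v *)
(* Solving the backward equations of the chain for the probabilities of being
   empty at time [t], averaged over the labels [j], leaves a birth-death system
   on the population sizes that is symmetric except at [0], where the rate is
   [d] times too large. Pairing it with the explicit geometric solution of the
   symmetric system (the case [d = 1]) gives the integral equation.

   The polynomial [A n] of the component numbers at [d], the sum over all
   permutations of [d] to the number of components, satisfies
   [A n = n! + (d - 1) \sum_(m < n) A m (n - m)!]. Hence [A n / n!] is bounded,
   the series converges for [lambda t < 1], and its partial sums satisfy the
   integral equation up to an error at most [A N.+1 / N.+1! (lambda t)^N.+1];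
   Gronwall's inequality compares them with the solution. *)
Require Import Defs.
From mathcomp Require Import all_boot all_order all_algebra all_fingroup.
From mathcomp Require Import all_classical all_reals all_analysis.
From mathcomp Require Import zify ring lra.
Import Order.TTheory GRing.Theory Num.Theory.
Import numFieldNormedType.Exports.

Set Implicit Arguments.
Unset Strict Implicit.
Unset Printing Implicit Defensive.

Local Open Scope nat_scope.

(** * Permutations counted by components *)

(** The label [j] only matters through the [d] exits of the empty state, each at rate [lambda].
    Since the asymmetry sits at [0] alone, it enters the pairing as a multiple of the derivative of
    the emptiness probability; integration by parts moves this derivative onto the geometric
    parameter and produces the squared kernel. The system is infinite, so the pairing is cut at a
    level [K], and the geometric decay of the explicit solution beats the linear growth of the rates
    in the boundary term. A transition function is constrained at nonnegative times only, and its
    rates are right limits at [0]. Composing with the absolute value of time gives functions that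
    are continuous on the whole line and differentiable at positive times, so that ordinary calculus
    applies. In the series part no double series is rearranged. Against the monomial of degree [m],
    the kernel is expanded to order [N - m], so that all expansions stop at the same total degree
    [N]; the recurrence cancels every lower coefficient and then, read at [N.+1], collects all the
    remainders into the single coefficient [A N.+1]. *)

Definition cut (n : nat) (s : 'S_n) (m : nat) : bool :=
  [forall i : 'I_n, (i < m) ==> (s i < m)].

(** [m = 0] is always a cut and [m = k] is left out. Thus [cuts s n] counts the first positions of
    the components, and [cuts s i.+1] is the rank, from 1, of the component that contains position
    [i]. *)
Definition cuts (n : nat) (s : 'S_n) (k : nat) : nat :=
  \sum_(m < k) cut s m.

(** By cardinality, a stable set is its own image; injectivity then makes its complement stable
    too. *)
Lemma perm_stable_mem (T : finType) (s : {perm T}) (A : {set T}) x :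
  {in A, forall y, s y \in A} -> s x \in A -> x \in A.
Proof.
move=> sA sx.
have /eqP sAE : s @: A == A.
  rewrite eqEcard card_imset ?leqnn ?andbT; last exact: perm_inj.
  by apply/fintype.subsetP => _ /imsetP[y yA ->]; exact: sA.
by move: sx; rewrite -{1}sAE => /imsetP[y yA /perm_inj ->].
Qed.

Lemma cut_ge n (s : 'S_n) m (j : 'I_n) : cut s m -> m <= j -> m <= s j.
Proof.
move=> /forallP cm; apply: contraLR; rewrite -!ltnNge => sj.
have /= := @perm_stable_mem _ s [set i : 'I_n | i < m]%SET j.
by rewrite !inE; apply => // i; rewrite !inE => im; have /implyP := cm i; apply.
Qed.

(** For the converse, if some [i < m] had [m <= s i], then every [j >= m] would have
    [s j > s i >= m]; the positions from [m] on would be stable and would have to contain [i]. *)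
Lemma cutP n (s : 'S_n) m :
  reflect (forall i j : 'I_n, i < m -> m <= j -> s i < s j) (cut s m).
Proof.
apply: (iffP idP) => [cm i j im mj|h].
  apply: leq_trans (cut_ge cm mj).
  by move/forallP : cm => /(_ i)/implyP; apply.
apply/forallP => i; apply/implyP => im; rewrite ltnNge; apply/negP => msi.
have := @perm_stable_mem _ s [set j : 'I_n | m <= j]%SET i.
rewrite !inE msi leqNgt im => H; suff : false by []; apply: H => // j.
by rewrite !inE => mj; rewrite (leq_trans msi)// ltnW// h.
Qed.

Lemma cut0 n (s : 'S_n) : cut s 0.
Proof. by apply/cutP. Qed.

Lemma cutsS n (s : 'S_n) k : cuts s k.+1 = cuts s k + cut s k.
Proof. by rewrite /cuts big_ord_recr. Qed.

Lemma leq_cuts n (s : 'S_n) : {homo cuts s : k l / k <= l}.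
Proof.
move=> k l /subnK <-; elim: (l - k) => [|i IH]; first by rewrite add0n.
by rewrite addSn cutsS (leq_trans IH) ?leq_addr.
Qed.

Lemma cuts_leq n (s : 'S_n) k : cuts s k <= k.
Proof.
elim: k => [|k IH]; first by rewrite /cuts big_ord0.
by rewrite cutsS -addn1 leq_add// leq_b1.
Qed.

Lemma cuts_gt0 n (s : 'S_n) k : 0 < k -> 0 < cuts s k.
Proof. by move=> k0; apply: leq_trans (leq_cuts s k0); rewrite cutsS cut0 addn1. Qed.

Lemma cuts_lt n (s : 'S_n) m i j :
  i < m -> m <= j -> cut s m -> cuts s i.+1 < cuts s j.+1.
Proof.
move=> im mj cm; apply: leq_trans (leq_cuts s (_ : m.+1 <= j.+1)) => //.
by rewrite (cutsS _ m) cm addn1 ltnS leq_cuts.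
Qed.

Lemma cuts_ltP n (s : 'S_n) i j : i <= j -> cuts s i.+1 < cuts s j.+1 ->
  exists2 m, i < m <= j & cut s m.
Proof.
elim: j => [|j IH]; first by rewrite leqn0 => /eqP ->; rewrite ltnn.
rewrite leq_eqVlt => /predU1P[->|]; first by rewrite ltnn.
rewrite ltnS => ij; rewrite (cutsS _ j.+1).
case: (boolP (cut s j.+1)) => [cj _|_].
  by exists j.+1 => //; rewrite ltnS ij leqnn.
by rewrite addn0 => /(IH ij)[m /andP[im mj] cm]; exists m => //; rewrite im leqW.
Qed.

(** The last cut at or before [i] opens the component of [i]; it is the representative by which the
    blocks are counted. *)
Lemma last_cut n (s : 'S_n) i :
  exists m, [/\ m <= i, cut s m & cuts s m.+1 = cuts s i.+1].
Proof.
elim: i => [|i [m [mi cm e]]]; first by exists 0; rewrite cut0.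
case: (boolP (cut s i.+1)) => [ci|/negbTE ci]; first by exists i.+1.
by exists m; rewrite (cutsS _ i.+1) ci addn0 e leqW.
Qed.

Definition blocks (n : nat) (s : 'S_n) : {set {set 'I_n}} :=
  preim_partition (fun i : 'I_n => cuts s i.+1) [set: 'I_n].

Lemma in_blocks n (s : 'S_n) A i j : A \in blocks s -> i \in A ->
  (j \in A) = (cuts s i.+1 == cuts s j.+1).
Proof.
case/imsetP => k _ ->; rewrite !inE/= => /eqP ->; rewrite eq_sym.
by rewrite [in RHS]eq_sym.
Qed.

Lemma card_blocks n (s : 'S_n) : #|blocks s| = cuts s n.
Proof.
pose blk (i : 'I_n) := [set j in [set: 'I_n] | cuts s i.+1 == cuts s j.+1]%SET.
have -> : blocks s = blk @: [set i : 'I_n | cut s i]%SET.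
  apply/setP => A; apply/imsetP/imsetP => -[i _ ->]; last by exists i.
  have [m [mi cm e]] := last_cut s i.
  exists (Ordinal (leq_ltn_trans mi (ltn_ord i))); first by rewrite inE.
  by apply/setP => j; rewrite !inE /= e.
rewrite card_in_imset; first by rewrite cardsE -sum1_card big_mkcond.
suff H (i j : 'I_n) : cut s j -> i < j -> blk i != blk j.
  move=> i j; rewrite !inE => ci cj e.
  by case: (ltngtP i j) => [/(H _ _ cj)|/(H _ _ ci)|/val_inj//]; rewrite e eqxx.
move=> cj ij; apply/eqP => /setP/(_ i); rewrite !inE eqxx/=.
by move=> /esym/eqP e; have := cuts_lt ij (leqnn j) cj; rewrite e ltnn.
Qed.

Lemma blocks_splitting n (s : 'S_n) : splitting s (blocks s).
Proof.
apply/and3P; split; first exact: preim_partitionP.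
- apply/forall_inP => A AQ; apply/forall_inP => i iA; apply/forall_inP => k kA.
  apply/forallP => j; apply/implyP => /andP[ij jk].
  move: kA; rewrite !(in_blocks _ AQ iA) => /eqP e.
  by rewrite eqn_leq leq_cuts ?e ?leq_cuts// ltnS ltnW.
- apply/forall_inP => A AQ; apply/forall_inP => B BQ; apply/implyP => AB.
  apply/forall_inP => i iA; apply/forall_inP => j jB; apply/implyP => ij.
  have : cuts s i.+1 < cuts s j.+1.
    rewrite ltn_neqAle leq_cuts ?ltnS ?(ltnW ij)// andbT.
    apply: contra AB => /eqP e; apply/eqP/setP => k.
    by rewrite (in_blocks _ AQ iA) (in_blocks _ BQ jB) e.
  move=> /(cuts_ltP (ltnW ij))[m /andP[im mj] /cutP]; exact.
Qed.

(** If a part of [Q] contains a position but not the next one, [j], then by convexity no part meets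
    both sides of [j], so [j] is a cut. Hence between two consecutive cuts membership in a part
    passes from each position to the next. *)
Lemma splitting_coarser n (s : 'S_n) Q A : splitting s Q -> A \in blocks s ->
  exists2 B, B \in Q & A \subset B.
Proof.
case/and3P => /and3P[/eqP covQ trivQ _] convQ ordQ AQ.
have inQ (i : 'I_n) : exists2 B, B \in Q & i \in B.
  by apply/bigcupP; rewrite -/(finset.cover Q) covQ inE.
have uniqQ B B' i : B \in Q -> B' \in Q -> i \in B -> i \in B' -> B = B'.
  by move=> BQ B'Q iB iB'; rewrite -(def_pblock trivQ BQ iB) (def_pblock trivQ B'Q iB').
have conv B (i k j : 'I_n) : B \in Q -> i \in B -> k \in B -> i <= j <= k -> j \in B.
  move=> BQ iB kB /andP[]; rewrite leq_eqVlt => /predU1P[/val_inj <-//|ij].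
  rewrite leq_eqVlt => /predU1P[/val_inj ->//|jk].
  move/forall_inP : convQ => /(_ _ BQ)/forall_inP/(_ _ iB)/forall_inP/(_ _ kB).
  by move=> /forallP/(_ j); rewrite ij jk.
have sep (l j : 'I_n) B : l.+1 = j -> B \in Q -> l \in B -> j \notin B -> cut s j.
  move=> lj BQ lB jB; apply/cutP => a c aj jc.
  have [A1 A1Q aA1] := inQ a; have [A2 A2Q cA2] := inQ c.
  have A12 : A1 != A2.
    apply: contraNneq jB => A12; rewrite -A12 in cA2.
    have lA : l \in A1 by apply: (conv _ a c) => //=; lia.
    have jA : j \in A1 by apply: (conv _ a c) => //; lia.
    by rewrite (uniqQ _ _ l BQ A1Q).
  move/forall_inP : ordQ => /(_ _ A1Q)/forall_inP/(_ _ A2Q)/implyP/(_ A12).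
  move=> /forall_inP/(_ _ aA1)/forall_inP/(_ _ cA2)/implyP; apply.
  exact: leq_trans jc.
have same (i j : 'I_n) B : i <= j -> cuts s i.+1 = cuts s j.+1 -> B \in Q ->
    (i \in B) = (j \in B).
  elim: {j}(nat_of_ord j) {-2}j (erefl (nat_of_ord j)) => [|l IH] j jl.
    by rewrite jl leqn0 => /eqP i0 _ _; have -> : i = j by apply: val_inj; rewrite /= i0 jl.
  rewrite leq_eqVlt => /predU1P[/val_inj ->//|ij] e BQ.
  have ln : l < n by rewrite (leq_trans _ (ltn_ord j))// jl.
  pose l' := Ordinal ln.
  have il : i <= l' by rewrite /= -ltnS -jl.
  have ijl : cuts s i.+1 = cuts s l'.+1.
    by apply/eqP; rewrite eqn_leq leq_cuts//= e leq_cuts// jl.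
  have ncj : ~~ cut s j.
    by apply/negP => /(cuts_lt ij (leqnn j)); rewrite e ltnn.
  have sepj B' : B' \in Q -> l' \in B' -> j \in B'.
    by move=> B'Q lB'; apply: contraNT ncj; exact: sep lB'.
  rewrite (IH l')//; apply/idP/idP => [|jB]; first exact: sepj.
  have [B' B'Q lB'] := inQ l'.
  by rewrite (uniqQ _ _ j BQ B'Q)// sepj.
case/imsetP : (AQ) => i _ Ai; have iA : i \in A by rewrite Ai !inE /=.
have [B BQ iB] := inQ i; exists B => //; apply/fintype.subsetP => j.
rewrite (in_blocks _ AQ iA) => /eqP e.
by case/orP: (leq_total i j) => ij; rewrite -?(same _ _ _ ij e BQ)// (same _ _ _ ij _ BQ).
Qed.

(** A part [A] of [Q] lies in some [B], itself inside some [A'] of [Q]; disjointness forces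
    [A = A'], hence [A = B]. Used in both directions, this identifies any finest splitting with
    [blocks s]. *)
Lemma refinement_anti (T : finType) (D : {set T}) (Q Q' : {set {set T}}) :
  finset.partition Q D ->
  (forall A, A \in Q -> exists2 B, B \in Q' & A \subset B) ->
  (forall B, B \in Q' -> exists2 A, A \in Q & B \subset A) -> Q \subset Q'.
Proof.
move=> /and3P[_ trivQ Q0] QQ' Q'Q; apply/fintype.subsetP => A AQ.
have [B BQ' AB] := QQ' _ AQ; have [A' A'Q BA'] := Q'Q _ BQ'.
have [x xA] : exists x, x \in A.
  by apply/set0Pn; apply: contraNneq Q0 => <-.
have xA' : x \in A' := fintype.subsetP BA' _ (fintype.subsetP AB _ xA).
have AA' : A' = A by rewrite -(def_pblock trivQ A'Q xA') (def_pblock trivQ AQ xA).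
by have -> : A = B by apply/eqP; rewrite finset.eqEsubset AB -AA'.
Qed.

Lemma has_componentsE n (s : 'S_n) k : has_components s k = (cuts s n == k).
Proof.
rewrite -card_blocks; apply/existsP/idP => [[Q /andP[/andP[sQ finQ] cQ]]|cQ].
  suff -> : blocks s = Q by [].
  have QB : forall A, A \in Q -> exists2 B, B \in blocks s & A \subset B.
    move=> A AQ; move/forallP : finQ => /(_ (blocks s)).
    rewrite blocks_splitting/= => /forall_inP/(_ _ AQ)/existsP[B /andP[]].
    by exists B.
  have BQ : forall A, A \in blocks s -> exists2 B, B \in Q & A \subset B.
    by move=> A; exact: splitting_coarser.
  apply/eqP; rewrite finset.eqEsubset; apply/andP; split.
    by apply: refinement_anti BQ QB; exact: preim_partitionP.
  by apply: refinement_anti QB BQ; case/and3P : sQ => + _ _; exact.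
exists (blocks s); rewrite cQ andbT /finest_splitting blocks_splitting/=.
apply/forallP => Q; apply/implyP => sQ; apply/forall_inP => A /(splitting_coarser sQ)[B BQ AB].
by apply/existsP; exists B; rewrite BQ.
Qed.

(** * Direct sums of permutations and the recurrence of the weights *)

Definition glue_fun m k (s : 'S_m) (t : 'S_k) (i : 'I_(m + k)) : 'I_(m + k) :=
  unsplit (match fintype.split i with inl a => inl (s a) | inr b => inr (t b) end).

Lemma glue_fun_inj m k (s : 'S_m) (t : 'S_k) : injective (glue_fun s t).
Proof.
apply: (can_inj (g := glue_fun s^-1 t^-1)) => i.
rewrite /glue_fun unsplitK -[RHS]splitK.
by case: (fintype.split i) => a; rewrite permK.
Qed.

Definition glue m k (s : 'S_m) (t : 'S_k) : 'S_(m + k) := perm (@glue_fun_inj m k s t).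

Lemma glue_lshift m k (s : 'S_m) (t : 'S_k) a : glue s t (lshift k a) = lshift k (s a).
Proof. by rewrite permE /glue_fun (unsplitK (inl a)). Qed.

Lemma glue_rshift m k (s : 'S_m) (t : 'S_k) b : glue s t (rshift m b) = rshift m (t b).
Proof. by rewrite permE /glue_fun (unsplitK (inr b)). Qed.

Lemma glue_inj m k : injective (fun st : 'S_m * 'S_k => glue st.1 st.2).
Proof.
move=> [s t] [s' t'] /= /permP e; congr pair; apply/permP => i.
  by apply: (@lshift_inj m k); have := e (lshift k i); rewrite !glue_lshift.
by apply: (@rshift_inj m k); have := e (rshift m i); rewrite !glue_rshift.
Qed.

Lemma cut_glue m k (s : 'S_m) (t : 'S_k) l : l <= m -> cut (glue s t) l = cut s l.
Proof.
move=> lm; apply/forallP/forallP => c i.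
  by have := c (lshift k i); rewrite glue_lshift.
case: (split_ordP i) => a ->; first by rewrite glue_lshift; exact: c.
by apply/implyP => /= H; lia.
Qed.

Lemma cuts_glue m k (s : 'S_m) (t : 'S_k) : cuts (glue s t) m = cuts s m.
Proof. by apply: eq_bigr => l _; rewrite cut_glue// ltnW. Qed.

Lemma glue_surj m k (u : 'S_(m + k)) : cut u m -> exists s t, u = glue s t.
Proof.
move=> cm.
(* The default values of [insubd] are never reached: the cut keeps the first [m] values below [m]
   and the others at or above [m]. *)
pose g (a : 'I_m) : 'I_m := insubd a (val (u (lshift k a))).
pose h (b : 'I_k) : 'I_k := insubd b (u (rshift m b) - m).
have gE a : g a = u (lshift k a) :> nat.
  by rewrite val_insubd; move/forallP : cm => /(_ (lshift k a))/implyP ->/=.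
have hE b : m + h b = u (rshift m b).
  have ub : m <= u (rshift m b) by apply: cut_ge => //=; rewrite leq_addr.
  by rewrite val_insubd ltn_subLR// ltn_ord subnKC.
have g_inj : injective g.
  move=> a b /(congr1 val) /=; rewrite !gE => /val_inj /perm_inj.
  exact: lshift_inj.
have h_inj : injective h.
  move=> a b /(congr1 (fun i => m + val i)) /=; rewrite !hE => /val_inj /perm_inj.
  exact: rshift_inj.
exists (perm g_inj), (perm h_inj); apply/permP => i; apply: val_inj.
case: (split_ordP i) => a ->; first by rewrite glue_lshift permE /= gE.
by rewrite glue_rshift permE /= hE.
Qed.

(** This is the [A n] of the overview. The empty permutation has no component, so the weight at
    [n = 0] is 1, the constant term of the series. *)
Definition weight (d n : nat) : nat := \sum_(s : 'S_n) d ^ cuts s n.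

(** A permutation with a cut at [m] is a direct sum: its cuts below [m] are those of the first
    summand, while the second is any of the [k!] permutations. *)
Lemma sum_cut_weight d m k :
  \sum_(u : 'S_(m + k) | cut u m) d ^ cuts u m = weight d m * k`!.
Proof.
transitivity (\sum_(u in (fun st : 'S_m * 'S_k => glue st.1 st.2) @: [set: _]) d ^ cuts u m).
  apply: eq_bigl => u; apply/idP/imsetP => [/glue_surj[s [t ->]]|[[s t] _ ->]].
    by exists (s, t).
  by rewrite cut_glue//; apply/forallP => i; rewrite !ltn_ord.
rewrite big_imset/=; last by move=> ? ? _ _; exact: glue_inj.
rewrite (eq_bigl predT); last by move=> ?; rewrite inE.
rewrite -(pair_bigA _ (fun s t => d ^ cuts (glue s t) m))/= big_distrl/=.
apply: eq_bigr => s _; under eq_bigr do rewrite cuts_glue.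
by rewrite sum_nat_const card_Sn mulnC.
Qed.

Lemma expn_cuts d n (s : 'S_n) k :
  d.+1 ^ cuts s k = 1 + d * \sum_(m < k | cut s m) d.+1 ^ cuts s m.
Proof.
elim: k => [|k IH]; first by rewrite /cuts !big_ord0 muln0.
rewrite big_mkcond big_ord_recr -big_mkcond/= cutsS expnD IH.
by case: cut => /=; rewrite ?expn1 ?expn0 ?IH; ring.
Qed.

(* Each permutation is counted with weight
   [d ^ c = 1 + (d - 1) (1 + d + .. + d ^ (c - 1))]; the [i]-th term of the
   geometric sum is attached to the [i]-th cut [m], which splits the permutation
   into a permutation of size [m] and an arbitrary one of size [n - m]. *)
Lemma weight_rec d n :
  weight d.+1 n = n`! + d * \sum_(m < n) weight d.+1 m * (n - m)`!.
Proof.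
rewrite /weight; under eq_bigr do rewrite expn_cuts.
rewrite big_split/= sum1_card card_Sn -big_distrr/=; congr (_ + _ * _).
under eq_bigr do rewrite big_mkcond/=; rewrite exchange_big/=.
apply: eq_bigr => m _; rewrite -big_mkcond/=.
have mn : m + (n - m) = n by rewrite subnKC// ltnW.
by have := sum_cut_weight d.+1 m (n - m); rewrite mn.
Qed.

(** Grouping by number of components is exhaustive because [cuts s n] lies between 1 and [n]; at
    [n = 0] the left side would be an empty sum but the weight is 1. *)
Lemma weightE d n : 0 < n ->
  \sum_(1 <= j < n.+1) num_perm_components n j * d ^ j = weight d n.
Proof.
move=> n0; transitivity (\sum_(1 <= j < n.+1) \sum_(s : 'S_n | j == cuts s n) d ^ cuts s n).
  apply: eq_bigr => j _; rewrite /num_perm_components -sum1_card big_distrl/=.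
  have E (s : 'S_n) : (s \in [pred s | has_components s j]) = (j == cuts s n).
    by rewrite inE has_componentsE eq_sym.
  by apply: eq_big => [s|s]; rewrite E// => /eqP ->; rewrite mul1n.
under eq_bigr do rewrite big_mkcond/=.
rewrite exchange_big/=; apply: eq_bigr => s _.
by rewrite -big_mkcond big_nat1_eq cuts_gt0// ltnS cuts_leq.
Qed.

(** * Factorial growth of the weights *)

Lemma fact_exchange c i j : (c + i)`! * (c + j)`! <= c`! * (c + i + j)`!.
Proof.
elim: j => [|j IH]; first by rewrite !addn0 mulnC.
rewrite !addnS !factS mulnCA [leqRHS]mulnCA leq_mul//; lia.
Qed.

(** By log-convexity of the factorial the product is largest at the ends. The two end terms give
    [k.+1!] each; when [k > 0] each of the [k - 1] others is at most [2! * k!], which adds at most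
    twice [k.+1!] more. *)
Lemma sum_fact_conv k : \sum_(1 <= m < k.+2) m`! * (k.+2 - m)`! <= 4 * k.+1`!.
Proof.
case: k => [|k]; first by rewrite big_nat1.
rewrite big_ltn// big_nat_recr//= subSnn subn1 (_ : 1`! = 1)// mul1n muln1.
suff : \sum_(2 <= m < k.+2) m`! * (k.+3 - m)`! <= k * (2 * k.+1`!).
  by rewrite [k.+2`!]factS => H; nia.
rewrite -[leqRHS](_ : \sum_(2 <= m < k.+2) 2 * k.+1`! = _); last first.
  by rewrite sum_nat_const_nat subn2.
rewrite !big_nat leq_sum// => m /andP[m2 mk].
have := fact_exchange 2 (m - 2) (k.+1 - m).
have -> : 2 + (m - 2) + (k.+1 - m) = k.+1 by lia.
have -> : 2 + (m - 2) = m by lia.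
by have -> : 2 + (k.+1 - m) = k.+3 - m by lia.
Qed.

(* The convolution is dominated by its extreme terms [m = 0], [m = 1] and
   [m = n - 1], so that [a n / n!] stays bounded. *)
Lemma fact_conv_bounded d (a : nat -> nat) :
  (forall n, a n = n`! + d * \sum_(m < n) a m * (n - m)`!) ->
  exists C, forall n, a n <= C * n`!.
Proof.
(* Half of [C] pays for [n!] and the term [m = 0], together [d.+1 * n!]. The other half pays for the
   remaining terms, at most [4 * d * C * (n - 1)!], as soon as [n >= 8 * d]. The sum in [C] covers
   [n < N]. *)
move=> aE; pose N := 8 * d + 2; pose C := 2 * d.+1 + \sum_(m < N) a m.
have a0 : a 0 = 1 by rewrite aE big_ord0 muln0 addn0.
exists C; elim/ltn_ind => n IH; have [nN|] := ltnP n N.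
  rewrite (leq_trans _ (leq_pmulr _ (fact_gt0 n)))//.
  by rewrite /C (bigD1 (Ordinal nN))//= addnCA leq_addr.
case: n IH => [|[|k]] IH; rewrite /N; [lia..|move=> Nk].
rewrite aE -(big_mkord xpredT (fun m => a m * (k.+2 - m)`!)) big_ltn// a0 mul1n subn0.
have H : \sum_(1 <= m < k.+2) a m * (k.+2 - m)`! <= C * (4 * k.+1`!).
  rewrite (leq_trans _ (leq_mul (leqnn C) (sum_fact_conv k)))// big_distrr/=.
  by rewrite !big_nat leq_sum// => m /andP[_ mk]; rewrite mulnA leq_mul// IH.
have dC : 2 * d.+1 <= C by rewrite leq_addr.
have f0 := fact_gt0 k.+1; rewrite [k.+2`!]factS.
move: H f0 dC Nk {IH}; move: (k.+1`!) (\sum_(_ <= _ < _) _) C => f S {}C.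
move=> H f0 dC Nk.
have H1 : d * S <= d * (C * (4 * f)) by rewrite leq_mul.
have H2 : (2 * d.+1) * (k.+2 * f) <= C * (k.+2 * f) by rewrite leq_mul.
have H3 : 8 * d * (C * f) <= k.+2 * (C * f) by rewrite leq_mul//; lia.
nia.
Qed.

(** * Backward equations of a transition function *)

Local Open Scope classical_set_scope.
Local Open Scope ring_scope.

Lemma near_cvg_eq (T : Type) (U : nbhsType) (F : set_system T) (FF : Filter F)
    (f g : T -> U) (l : U) :
  {near F, f =1 g} -> f @ F --> l -> g @ F --> l.
Proof. by move=> fg; apply: cvg_trans; exact: near_eq_cvg. Qed.

(** Chapman-Kolmogorov with only finitely many intermediate states: as [p t y z <= 1], the discarded
    part is at most the mass that [p s x] puts outside [F]. This is how infinite sums leave the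
    argument. *)
Lemma transition_split (R : realType) (S : countType) (q : S -> S -> R)
    (p : R -> S -> S -> R) (s t : R) (x z : S) (F : seq S) :
  transition_function q p -> uniq F -> 0 <= s -> 0 <= t ->
  (forall y, p t y z <= 1) ->
  0 <= p (s + t) x z - \sum_(y <- F) p s x y * p t y z
    <= 1 - \sum_(y <- F) p s x y.
Proof.
move=> tf uF s0 t0 p1.
have esumF (a : S -> R) : (forall y, 0 <= a y) ->
    \esum_(y in [set: S]) (a y)%:E =
    ((\sum_(y <- F) a y)%:E + \esum_(y in ~` [set` F]) (a y)%:E)%E.
  move=> a0; rewrite (esumID [set` F]); last by move=> y _; rewrite lee_fin.
  rewrite !setTI esum_fset; [|exact: finite_seq|by move=> y _; rewrite lee_fin].
  by rewrite -fsbig_seq// sumEFin.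
have := tf_sum1 tf x s0; have := tf_Chapman_Kolmogorov tf x z s0 t0.
have psx y := tf_ge0 tf x y s0; have ptz y := tf_ge0 tf y z t0.
rewrite !esumF//; last by move=> y; rewrite mulr_ge0.
set r := esum _ _; set r' := esum _ _ => CK sum1.
have r0 : (0 <= r)%E by apply: esum_ge0 => y _; rewrite lee_fin mulr_ge0.
have rr' : (r <= r')%E.
  by apply: le_esum => y _; rewrite lee_fin ler_piMr.
move: r r' r0 rr' CK sum1 => [r||] [r'||]//=.
rewrite !lee_fin => r0 rr' [->] [sum1].
rewrite addrAC subrr add0r r0/=; move: sum1; set B := \sum_(_ <- _) _; lra.
Qed.

Lemma transition_le1 (R : realType) (S : countType) (q : S -> S -> R)
    (p : R -> S -> S -> R) (t : R) (x z : S) :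
  transition_function q p -> 0 <= t -> p t x z <= 1.
Proof.
move=> tf t0; rewrite -lee_fin -(tf_sum1 tf x t0) (esumID [set z]); last first.
  by move=> y _; rewrite lee_fin (tf_ge0 tf).
rewrite setTI esum_set1 ?lee_fin ?(tf_ge0 tf)// leeDl//.
by apply: esum_ge0 => y _; rewrite lee_fin (tf_ge0 tf).
Qed.

(** Turns the right limits that define the rates into the punctured two-sided limits of a
    derivative. *)
Lemma cvg_norm_dnbhs0 (R : realType) (f : R -> R) (l : R) :
  f h @[h --> (0 : R)^'+] --> l -> f `|h : R| @[h --> (0 : R)^'] --> l.
Proof.
move=> fl; have : `|h : R| @[h --> (0 : R)^'] --> (0 : R)^'+.
  move=> A [e /= e0 He]; exists e => //= h /=; rewrite sub0r normrN => he h0.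
  by apply: He => /=; rewrite ?sub0r ?normrN ?normr_id ?normr_gt0.
by move=> /cvg_comp; exact.
Qed.

Lemma is_derive1_cvg (R : realType) (f : R -> R) (t l : R) :
  (f (h + t) - f t) / h @[h --> 0^'] --> l -> is_derive t 1 f l.
Proof.
move=> fl.
have fl' : h^-1 *: ((f \o shift t) (h *: 1) - f t) @[h --> 0^'] --> l.
  by apply: near_cvg_eq fl; near=> h => /=; rewrite [h%:A]mulr1 mulrC.
apply: DeriveDef; first by apply/cvg_ex; exists l.
exact: cvg_lim.
Unshelve. all: by end_near. Qed.

Section backward_equation.
Context (R : realType) (S : countType) (q : S -> S -> R) (p : R -> S -> S -> R).
Context (tf : transition_function q p) (x : S) (F : seq S).
Hypotheses (F_uniq : uniq F) (xF : x \notin F).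
Hypotheses (q_ge0 : forall y, 0 <= q x y).
Hypotheses (qF : forall y, y != x -> y \notin F -> q x y = 0).

Lemma exit_rateE :
  ((1 - p h x x) / h) @[h --> 0^'+] --> \sum_(y <- F) q x y.
Proof.
apply: (@fine_cvg _ _ _ _ (fun h => ((1 - p h x x) / h)%:E)).
rewrite (_ : (_%:E) = \esum_(y in [set y | y != x]) (q x y)%:E)%E.
  exact: tf_exit_rate tf x.
rewrite (esumID [set` F]); last by move=> y _; rewrite lee_fin.
rewrite [X in (_ + X)%E]esum1 ?adde0; last first.
  by move=> y [/= yx /negP yF]; rewrite qF.
rewrite (_ : _ `&` _ = [set` F]); last first.
  apply/seteqP; split=> [y []//|y /= yF]; split => //.
  by apply: contraNneq xF => <-.
rewrite esum_fset; [|exact: finite_seq|by move=> y _; rewrite lee_fin].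
by rewrite -fsbig_seq// sumEFin.
Qed.

Lemma stay_prob_cvg : p h x x @[h --> 0^'+] --> (1 : R).
Proof.
have id0 : h @[h --> (0 : R)^'+] --> (0 : R) by apply: cvg_at_right_filter; exact: cvg_id.
have : 1 - (1 - p h x x) / h * h @[h --> 0^'+] -->
    (1 - (\sum_(y <- F) q x y) * 0 : R).
  by apply: cvgB; [exact: cvg_cst|apply: cvgM => //; exact: exit_rateE].
rewrite mulr0 subr0; apply: near_cvg_eq; near=> h.
have h0 : 0 < h by near: h; exact: nbhs_right_gt.
by rewrite divfK ?gt_eqF// subKr.
Unshelve. all: by end_near. Qed.

(** Start the longer time by a delay of length [|b - a|]: unless the chain has left [x] after it,
    the remaining time is the shorter one. *)
Lemma transition_increment (z : S) (a b : R) : 0 <= a -> 0 <= b ->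
  `|p b x z - p a x z| <= 2 * (1 - p `|b - a| x x).
Proof.
wlog ab : a b / a <= b => [H a0 b0|a0 b0].
  have [ab|/ltW ba] := leP a b; first exact: H.
  by rewrite distrC [`|b - a|]distrC H.
have h0 : 0 <= b - a by rewrite subr_ge0.
have := transition_split x tf (isT : uniq [:: x]) h0 a0 (fun y => transition_le1 y z tf a0).
rewrite subrK !big_seq1 (ger0_norm h0) => /andP[].
have := transition_le1 x z tf a0; have := tf_ge0 tf x z a0.
have := transition_le1 x x tf h0; rewrite ler_norml.
set u := p _ _ _; set v := p _ _ _; set w := p _ _ _ => ? ? ? ? ?.
apply/andP; split; nra.
Qed.

Lemma transition_continuous (z : S) : continuous (fun t : R => p `|t| x z).
Proof.
have stay0 : p `|h| x x @[h --> (0 : R)] --> (1 : R).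
  have -> : 1 = p `|0 : R| x x by rewrite normr0 (tf_time0 tf) eqxx.
  apply/(@continuous_withinNx _ _ (fun h : R => p `|h| x x)).
  rewrite normr0 (tf_time0 tf) eqxx.
  exact: cvg_norm_dnbhs0 stay_prob_cvg.
move=> t; apply/subr_cvg0.
have dist0 : `|s| - `|t| @[s --> t] --> (`|t| - `|t| : R).
  by apply: cvgB; [exact: norm_continuous|exact: cvg_cst].
have : 2 * (1 - p `| `|s| - `|t| | x x) @[s --> t] --> (2 * (1 - 1) : R).
  apply: cvgM; first exact: cvg_cst.
  apply: cvgB; first exact: cvg_cst.
  by rewrite subrr in dist0; exact: cvg_comp stay0.
rewrite subrr mulr0 => bnd0.
apply/norm_cvg0P; apply: (squeeze_cvgr _ (cvg_cst 0) bnd0).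
by near=> s; rewrite normr_ge0/= transition_increment.
Unshelve. all: by end_near. Qed.

(** The derivative is two-sided although the rates come from the right. A negative increment is read
    as a positive one that starts from an earlier time, and continuity of all [p y z] at [t] absorbs
    the shift. *)
Lemma transition_backward (z : S) (t : R) :
  (forall y, continuous (fun t : R => p `|t| y z)) -> 0 < t ->
  is_derive t 1 (fun t : R => p `|t| x z) (\sum_(y <- F) q x y * (p t y z - p t x z)).
Proof.
move=> pc t0; apply: is_derive1_cvg.
(* [tau h] is the minimum of [t] and [t + h], so for either sign of [h] the times compared are
   [tau h] and [|h| + tau h]. *)
pose tau (h : R) := t + (h - `|h|) / 2.
pose approx (h : R) := \sum_(y <- F) p `|h| x y / `|h| * p `|tau h| y z
  - (1 - p `|h| x x) / `|h| * p `|tau h| x z.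
(* [rho h] is the mass outside [x :: F] after time [|h|], divided by [|h|]. It vanishes in the limit
   because the exit rate is the sum of the jump rates into [F]. *)
pose rho (h : R) := (1 - p `|h| x x) / `|h| - \sum_(y <- F) p `|h| x y / `|h|.
have exitN : (1 - p `|h| x x) / `|h| @[h --> (0 : R)^'] --> \sum_(y <- F) q x y.
  exact: (@cvg_norm_dnbhs0 R (fun h => (1 - p h x x) / h) _ exit_rateE).
have jumpN y : y \in F -> p `|h| x y / `|h| @[h --> (0 : R)^'] --> q x y.
  move=> yF; apply: (@cvg_norm_dnbhs0 R (fun h => p h x y / h)); apply: (tf_jump_rate tf).
  by apply: contraNneq xF => ->.
have tauN : tau h @[h --> (0 : R)^'] --> t.
  have : tau h @[h --> (0 : R)] --> (t + (0 - `|0 : R|) / 2 : R).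
    apply: cvgD; first exact: cvg_cst.
    apply: cvgM; last exact: cvg_cst.
    by apply: cvgB; [exact: cvg_id|exact: norm_continuous].
  by rewrite normr0 subrr mul0r addr0; exact: cvg_within_filter.
have pN y : p `|tau h| y z @[h --> (0 : R)^'] --> p t y z.
  by have := cvg_comp _ _ tauN (pc y t); rewrite (gtr0_norm t0).
have sum_cvg (f : S -> R -> R) (l : S -> R) :
    (forall y, y \in F -> f y h @[h --> (0 : R)^'] --> l y) ->
    \sum_(y <- F) f y h @[h --> (0 : R)^'] --> \sum_(y <- F) l y.
  move=> fl; under eq_fun do rewrite big_seq; rewrite big_seq.
  by apply: cvg_big => //; exact: add_continuous.
have approxN : approx h @[h --> (0 : R)^'] --> \sum_(y <- F) q x y * (p t y z - p t x z).
  under eq_bigr do rewrite mulrBr; rewrite sumrB -mulr_suml.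
  apply: cvgB; last by apply: cvgM.
  apply: (sum_cvg (fun y h => p `|h| x y / `|h| * p `|tau h| y z)) => y yF.
  by apply: cvgM => //; exact: jumpN.
have rhoN : rho h @[h --> (0 : R)^'] --> (0 : R).
  have : rho h @[h --> (0 : R)^'] --> \sum_(y <- F) q x y - \sum_(y <- F) q x y.
    by apply: cvgB => //; exact: (sum_cvg (fun y h => p `|h| x y / `|h|)).
  by rewrite subrr.
have : approx h + rho h @[h --> (0 : R)^'] -->
    (\sum_(y <- F) q x y * (p t y z - p t x z) + 0 : R).
  exact: cvgD.
rewrite addr0 => approx_rhoN.
apply: (squeeze_cvgr _ approxN approx_rhoN); near=> h.
have h0 : 0 < `|h| by rewrite normr_gt0; near: h; exact: nbhs_dnbhs_neq.
have ht : `|h| < t.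
  near: h; apply: (cvgr_lt `|0 : R|); last by rewrite normr0.
  by apply: cvg_within_filter; exact: norm_continuous.
have tau0 : 0 <= tau h.
  by move: ht; rewrite ltr_norml /tau => /andP[]; have := ler_norm h; have := ler_norm (- h);
    rewrite normrN; case: (ger0P h); lra.
have -> : (p `|h + t| x z - p `|t| x z) / h = (p (`|h| + tau h) x z - p (tau h) x z) / `|h|.
  move: ht; rewrite (gtr0_norm t0) /tau; case: (ltrgt0P h) h0; last by rewrite ltxx.
    by move=> h0 _ ht; rewrite subrr mul0r addr0 ger0_norm// addr_ge0// ltW.
  move=> h0 _ ht; have -> : t + (h - - h) / 2 = h + t by field.
  have -> : - h + (h + t) = t by ring.
  rewrite ger0_norm; last by lra.
  by rewrite invrN mulrN -mulNr opprB.
have uxF : uniq (x :: F) by rewrite /= xF.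
have := transition_split x tf uxF (ltW h0) tau0 (fun y => transition_le1 y z tf tau0).
rewrite !big_cons => /andP[lo up].
rewrite /approx /rho (ger0_norm tau0) -mulr_suml.
have -> : \sum_(y <- F) p `|h| x y / `|h| * p (tau h) y z =
    (\sum_(y <- F) p `|h| x y * p (tau h) y z) / `|h|.
  by rewrite mulr_suml; apply: eq_bigr => y _; rewrite mulrAC.
move: lo up; set A := \sum_(y <- F) _ * _; set B := \sum_(y <- F) _.
set u := p `|h| x x; set v := p (tau h) x z; set w := p _ x z => lo up.
apply/andP; split; rewrite -subr_ge0.
  rewrite (_ : _ - _ = (w - (u * v + A)) / `|h|); last by ring.
  by rewrite mulr_ge0// invr_ge0.
rewrite (_ : _ - _ = (1 - (u + B) - (w - (u * v + A))) / `|h|); last by ring.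
by rewrite mulr_ge0 ?invr_ge0// subr_ge0.
Unshelve. all: by end_near. Qed.
End backward_equation.

(** * The Volterra equation of the birth-death system *)

Lemma is_derive1M (R : realType) (f g : R -> R) (x a b : R) :
  is_derive x 1 f a -> is_derive x 1 g b ->
  is_derive x 1 (fun y => f y * g y) (a * g x + f x * b).
Proof.
move=> fa gb; have := is_deriveM fa gb; rewrite /GRing.scale/= addrC (mulrC (g x)).
exact.
Qed.

Lemma is_derive1X (R : realType) (f : R -> R) (n : nat) (x a : R) :
  is_derive x 1 f a ->
  is_derive x 1 (fun y => f y ^+ n) (n%:R * f x ^+ n.-1 * a).
Proof.
move=> fa; have -> : (fun y => f y ^+ n) = f ^+ n.
  by apply/funext => y; elim: n => [|n IH]; rewrite ?expr0// !exprS IH.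
exact: is_deriveX.
Qed.

Lemma is_derive1_sum (R : realType) n (f : nat -> R -> R) (df : nat -> R) (x : R) :
  (forall k, is_derive x 1 (f k) (df k)) ->
  is_derive x 1 (fun y => \sum_(k < n) f k y) (\sum_(k < n) df k).
Proof.
move=> h; have -> : (fun y => \sum_(k < n) f k y) = \sum_(k < n) f k.
  by apply/funext => y; rewrite fct_sumE.
exact: is_derive_sum.
Qed.

Lemma continuous_integrable (R : realType) (f : R -> R) (a b : R) :
  (forall x, x \in `[a, b]%R -> {for x, continuous f}) ->
  lebesgue_measure.-integrable `[a, b] (EFin \o f).
Proof.
move=> cf; apply: continuous_compact_integrable; first exact: segment_compact.
by apply: continuous_in_subspaceT => x; rewrite inE => xab; exact: cf.
Qed.

Lemma primitive_continuous (R : realType) (f : R -> R) (b : R) : 0 < b ->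
  (forall x, x \in `[0, b]%R -> {for x, continuous f}) ->
  {within `[0, b], continuous (fun s => \int[lebesgue_measure]_(y in `[0, s]) f y)}.
Proof.
move=> b0 cf; apply: parameterized_integral_continuous; first exact: ltW.
exact: continuous_integrable.
Qed.

Lemma primitive_derive (R : realType) (f : R -> R) (b s : R) : s \in `]0, b[%R ->
  (forall x, x \in `[0, b]%R -> {for x, continuous f}) ->
  is_derive s 1 (fun s => \int[lebesgue_measure]_(y in `[0, s]) f y) (f s).
Proof.
move=> sb cf; have /itvP sbP := sb.
have s_ltb : s < b by rewrite sbP.
have cs : {for s, continuous f} by apply: cf; rewrite in_itv/= !ltW ?sbP.
have [|dF <-] := continuous_FTC1 s_ltb (continuous_integrable cf) _ cs.
  by rewrite /Order.lt/= sbP.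
by rewrite derive1E; exact/derivableP.
Qed.

Lemma mean_value_bound (R : realType) (f df : R -> R) (b M : R) : 0 < b ->
  (forall x, x \in `]0, b[%R -> is_derive x 1 f (df x)) ->
  {within `[0, b], continuous f} ->
  (forall x, x \in `]0, b[%R -> `|df x| <= M) -> `|f b - f 0| <= M * b.
Proof.
move=> b0 dF cF dfM; have [c cab ->] := MVT b0 dF cF.
by rewrite subr0 normrM (gtr0_norm b0) ler_pM2r// dfM.
Qed.

(** With [s] the square root of [r], [K.+1 * s ^ K] is at most the geometric sum [1 + .. + s ^ K],
    hence bounded; the other factor [s ^ K] tends to 0. *)
Lemma linear_geometric_squeeze (R : realType) (x c r : R) : 0 <= r -> r < 1 ->
  (forall K, `|x| <= c * (K.+1%:R * r ^+ K)) -> x = 0.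
Proof.
move=> r0 r1 xc; pose s := Num.sqrt r.
have s0 : 0 <= s by rewrite sqrtr_ge0.
have rs : r = s ^+ 2 by rewrite sqr_sqrtr.
have s1 : s < 1 by rewrite -(sqrtr1 R) ltr_sqrt.
have c0 : 0 <= c by have := xc 0; rewrite expr0 !mulr1; apply: le_trans.
have sum_le K : K.+1%:R * s ^+ K <= (1 - s)^-1.
  rewrite -[leRHS]mul1r ler_pdivlMr ?subr_gt0//.
  apply: (@le_trans _ _ (1 - s ^+ K.+1)); last by rewrite gerBl exprn_ge0.
  have -> : 1 - s ^+ K.+1 = (1 - s) * \sum_(i < K.+1) s ^+ i.
    by rewrite -opprB subrX1 -mulNr opprB.
  rewrite mulrC ler_wpM2l ?subr_ge0 ?(ltW s1)//.
  rewrite mulr_natl -[X in _ *+ X]card_ord -sumr_const ler_sum// => i _.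
  by apply: ler_wiXn2l => //; [exact: ltW|rewrite -ltnS].
have : (fun K => c / (1 - s) * s ^+ K) @ \oo --> (0 : R).
  have := @cvg_geometric R (c / (1 - s)) s; rewrite ger0_norm//; exact.
move=> lim0; apply/eqP; rewrite -normr_le0.
apply: (ler_cvg_to (cvg_cst `|x|) lim0); apply: nearW => K.
apply: (le_trans (xc K)); rewrite rs exprAC expr2 mulrA -!mulrA ler_wpM2l// mulrA.
by rewrite ler_wpM2r// exprn_ge0.
Qed.

(** Discrete Green identity: with birth rates [k + 1] and death rates [k] the forward operator on
    [a] and the backward operator on [b] coincide, so only a Wronskian-like boundary term survives.
    At [k = 0] the value [a 0.-1] carries the factor 0. *)
Lemma birth_death_telescope (R : comRingType) (a b : nat -> R) (n : nat) :
  \sum_(k < n.+1)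
     (- (k%:R * a k.-1 + k.+1%:R * a k.+1 - (k%:R + k.+1%:R) * a k) * b k
      + a k * (k.+1%:R * (b k.+1 - b k) + k%:R * (b k.-1 - b k)))
  = n.+1%:R * (a n * b n.+1 - a n.+1 * b n).
Proof.
elim: n => [|n IH]; first by rewrite big_ord1 /=; ring.
by rewrite big_ord_recr/= {}IH -!natr1; ring.
Qed.

(* With immigration rate [lambda] the chain of the population sizes is
   symmetric, and from [0] it has at time [u] the geometric distribution
   [k |-> G k] with parameter [1 / (1 + lambda u)]. Here [u = t - s]. *)
Lemma birth_death_volterra (R : realType) (lambda D B t : R) (v : nat -> R -> R) :
  0 < lambda -> 0 < D -> 0 < t ->
  (forall k, continuous (v k)) ->
  (forall s : R, 0 < s ->
    is_derive s 1 (v 0%N) (lambda * D * (v 1%N s - v 0%N s))) ->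
  (forall k (s : R), 0 < s -> is_derive s 1 (v k.+1)
    (lambda * (k.+2%:R * (v k.+2 s - v k.+1 s) + k.+1%:R * (v k s - v k.+1 s)))) ->
  (forall k s, 0 <= s -> `|v k s| <= B) ->
  (forall k, v k 0 = (k == 0%N)%:R) ->
  v 0%N t = 1 / (1 + lambda * t) - lambda * (D - 1) *
    \int[lebesgue_measure]_(y in `[0, t]) (v 0%N y / (1 + lambda * (t - y)) ^+ 2).
Proof.
move=> lambda_gt0 D_gt0 t0 vc v0D vD vB v0.
pose g (s : R) := (1 + lambda * (t - s))^-1.
pose G k (s : R) := g s * (1 - g s) ^+ k.
pose h (y : R) := v 0%N y / (1 + lambda * (t - y)) ^+ 2.
pose I (s : R) := \int[lebesgue_measure]_(y in `[0, s]) h y.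
have den_gt0 s : s <= t -> 0 < 1 + lambda * (t - s).
  by move=> st; rewrite ltr_pwDl// mulr_ge0 ?subr_ge0// ltW.
have dg s : s <= t -> is_derive s 1 g (lambda * g s ^+ 2).
  move=> st; have dl : is_derive s (1 : R) (fun s => 1 + lambda * (t - s)) (- lambda).
    apply: is_derive_eq; rewrite /GRing.scale/=; ring.
  have := @is_deriveV _ (fun s => 1 + lambda * (t - s)) _ _ _ (lt0r_neq0 (den_gt0 s st)) dl.
  by rewrite /GRing.scale/= mulrNN mulrC -exprVn.
have dG k s : s <= t -> is_derive s 1 (G k)
    (- lambda * (k%:R * G k.-1 s + k.+1%:R * G k.+1 s - (k%:R + k.+1%:R) * G k s)).
  move=> st; have dgs := dg s st.
  have d1g : is_derive s (1 : R) (fun s => (1 - g s) ^+ k)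
      (- (k%:R * (1 - g s) ^+ k.-1 * (lambda * g s ^+ 2))).
    have d1 : is_derive s (1 : R) (fun s => 1 - g s) (- (lambda * g s ^+ 2)).
      by apply: is_derive_eq; rewrite add0r mul1r.
    by have := is_derive1X k d1; rewrite mulrN.
  apply: (is_derive_eq (is_derive1M dgs d1g)).
  rewrite /G; case: k {d1g} => [|k] /=; first by rewrite !expr0 expr1; ring.
  by rewrite !exprS -!natr1; ring.
have cg s : s <= t -> {for s, continuous g}.
  by move=> st; apply: differentiable_continuous; apply/derivable1_diffP; case: (dg s st).
have cG k s : s <= t -> {for s, continuous (G k)}.
  by move=> st; apply: differentiable_continuous; apply/derivable1_diffP; case: (dG k s st).
have ch s : s \in `[0, t]%R -> {for s, continuous h}.
  rewrite in_itv/= => /andP[_ st].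
  have -> : h = (fun y => v 0%N y * (g y * g y)).
    by apply/funext => y; rewrite /h /g -expr2 exprVn.
  by apply: cvgM; [exact: vc|apply: cvgM; exact: cg].
(* Up to the boundary term, the pairing has derivative [lambda (D - 1) g (v 1 - v 0)], which is [c]
   times [g] times the derivative of [v 0]. As [g' = lambda g ^ 2], the last two terms of [T]
   compensate it, and [dT] is the boundary term alone. *)
pose c := (D - 1) / D.
pose T K (s : R) := \sum_(k < K.+1) G k s * v k s - c * (g s * v 0%N s) + c * lambda * I s.
pose dT K s := lambda * (K.+1%:R * (G K s * v K.+1 s - G K.+1 s * v K s)).
have derT K s : s \in `]0, t[%R -> is_derive s 1 (T K) (dT K s).
  move=> sI; have /itvP sP := sI; have s0 : 0 < s by rewrite sP.
  have st : s <= t by rewrite ltW ?sP.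
  have dI : is_derive s 1 I (h s) := primitive_derive sI ch.
  pose dv k := if k is k'.+1
    then lambda * (k'.+2%:R * (v k'.+2 s - v k'.+1 s)
                   + k'.+1%:R * (v k' s - v k'.+1 s))
    else lambda * D * (v 1%N s - v 0%N s).
  have vd k : is_derive s 1 (v k) (dv k) by case: k => [|k]; [exact: v0D|exact: vD].
  have dS := is_derive1_sum K.+1 (fun k => is_derive1M (dG k s st) (vd k)).
  have dgv := is_derive1M (dg s st) (vd 0%N).
  have dTs := is_deriveD (is_deriveB dS (is_deriveZ c dgv)) (is_deriveZ (c * lambda) dI).
  apply: (is_derive_eq dTs); rewrite /GRing.scale/= {dTs dS dgv dI}.
  pose tel (k : nat) := - (k%:R * G k.-1 s + k.+1%:R * G k.+1 s - (k%:R + k.+1%:R) * G k s) * v k s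
    + G k s * (k.+1%:R * (v k.+1 s - v k s) + k%:R * (v k.-1 s - v k s)).
  have -> : \sum_(k < K.+1) (- lambda * (k%:R * G k.-1 s + k.+1%:R * G k.+1 s
        - (k%:R + k.+1%:R) * G k s) * v k s + G k s * dv k) =
      lambda * \sum_(k < K.+1) tel k + lambda * (D - 1) * g s * (v 1%N s - v 0%N s).
    rewrite mulr_sumr [in LHS]big_ord_recl [in RHS]big_ord_recl /=.
    rewrite [in RHS]addrAC; congr (_ + _).
      by rewrite /tel /G /= !expr0 !expr1; ring.
    by apply: eq_bigr => k _; rewrite /tel /bump /= add1n /=; ring.
  rewrite /tel (birth_death_telescope (fun k => G k s) (fun k => v k s)) /dT.
  rewrite /h -exprVn -/(g s) /c; field; exact: lt0r_neq0.
pose rho := 1 - g 0.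
have g0E : g 0 = (1 + lambda * t)^-1 by rewrite /g subr0.
have lt0 : 0 < lambda * t by rewrite mulr_gt0.
have g0_gt0 : 0 < g 0 by rewrite g0E invr_gt0 addr_gt0.
have g_bnd s : s \in `]0, t[%R -> g 0 <= g s <= 1.
  move=> /itvP sP; have st : s <= t by rewrite ltW ?sP.
  have ls : 0 <= lambda * (t - s) by rewrite mulr_ge0 ?subr_ge0// ltW.
  apply/andP; split.
    rewrite /g subr0 lef_pV2 ?posrE ?den_gt0//; last by rewrite addr_gt0.
    by rewrite lerD2l ler_pM2l// lerBlDr lerDl ltW ?sP.
  by rewrite /g invf_le1 ?den_gt0// lerDl.
have rho0 : 0 <= rho by rewrite subr_ge0 g0E invf_le1 ?lerDl ?ltW// addr_gt0.
have rho1 : rho < 1 by rewrite gtrBl.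
have B0 : 0 <= B by apply: le_trans (vB 0%N 0 (lexx 0)).
have G_bnd k s : s \in `]0, t[%R -> `|G k s| <= rho ^+ k.
  move=> /g_bnd/andP[gs0 gs1]; have gs : 0 <= g s by apply: le_trans gs0; exact: ltW.
  have ogs : 0 <= 1 - g s by rewrite subr_ge0.
  rewrite /G normrM normrX !ger0_norm//.
  rewrite (le_trans (ler_piMl _ gs1)) ?exprn_ge0// lerXn2r ?nnegrE//.
  by rewrite lerD2l lerN2.
have dT_bnd K s : s \in `]0, t[%R -> `|dT K s| <= lambda * (K.+1%:R * (2 * B * rho ^+ K)).
  move=> sI; rewrite /dT normrM (gtr0_norm lambda_gt0) ler_pM2l//.
  rewrite normrM ger0_norm// ler_pM2l// (le_trans (ler_normB _ _))//.
  rewrite (normrM (G K s)) (normrM (G K.+1 s)).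
  have /itvP sP := sI; have s0 : 0 <= s by rewrite ltW ?sP.
  have GK1 : `|G K.+1 s| <= rho ^+ K.
    apply: le_trans (G_bnd _ _ sI) _; rewrite exprS ler_piMl ?exprn_ge0//.
    exact: ltW.
  have -> : 2 * B * rho ^+ K = rho ^+ K * B + rho ^+ K * B by ring.
  by apply: lerD; apply: ler_pM => //; [exact: G_bnd|exact: vB|exact: vB].
have cT K : {within `[0, t], continuous (T K)}.
  have cI := primitive_continuous t0 ch.
  have cS : {within `[0, t], continuous (fun s => \sum_(k < K.+1) G k s * v k s - c * (g s * v 0%N s))}.
    apply: continuous_in_subspaceT => s; rewrite inE /= in_itv/= => /andP[_ st].
    apply: cvgB; last by apply: cvgM; [exact: cvg_cst|apply: cvgM; [exact: cg|exact: vc]].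
    by apply: cvg_big => [|k _]; [exact: add_continuous|apply: cvgM; [exact: cG|exact: vc]].
  move=> s; apply: cvgD; first exact: cS.
  by apply: cvgM; [exact: cvg_cst|exact: cI].
have I0 : I 0 = 0 by rewrite /I set_itv1 Rintegral_set1.
have gt1 : g t = 1 by rewrite /g subrr mulr0 addr0 invr1.
(* [X] is [T K t - T K 0] for every [K]: for [k > 0] both [G k t] and [v k 0] vanish. Since
   [1 - c = 1 / D], the equation [X = 0] times [D] is the claim. *)
pose X := v 0%N t - c * v 0%N t + c * lambda * I t - (g 0 - c * g 0).
have XE K : X = T K t - T K 0.
  rewrite /T I0 mulr0 addr0 gt1 mul1r v0 mulr1 /X.
  rewrite big_ord_recl big1 => [|k _]; last first.
    by rewrite /G gt1 subrr lift0 expr0n/= mulr0 mul0r.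
  rewrite [in RHS]big_ord_recl [in RHS]big1 => [|k _]; last first.
    by rewrite v0 lift0 mulr0.
  by rewrite /G gt1 v0 expr0 !mulr1 mul1r !addr0.
have X0 : X = 0.
  apply: (@linear_geometric_squeeze _ X (lambda * (2 * B) * t) rho) => // K.
  rewrite (XE K); apply: le_trans (mean_value_bound t0 (derT K) (cT K) (dT_bnd K)) _.
  by rewrite le_eqVlt; apply/orP; left; apply/eqP; ring.
have : X * D = 0 by rewrite X0 mul0r.
rewrite /X /c g0E => XD; rewrite -/h -/(I t); apply/eqP; rewrite -subr_eq0; apply/eqP.
rewrite -[RHS]XD; field; apply/andP; split; apply: lt0r_neq0 => //.
by rewrite addr_gt0.
Qed.

(** * Series solution of the Volterra equation *)

(** The mean value theorem for [g - e f] with [e = 1] and [e = -1]. It bounds a remainder through a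
    primitive of the bound, with no comparison of integrals. *)
Lemma derive_dominated (R : realType) (f df g dg : R -> R) (b : R) : 0 < b ->
  (forall y, y \in `]0, b[%R -> is_derive y 1 f (df y)) ->
  (forall y, y \in `]0, b[%R -> is_derive y 1 g (dg y)) ->
  {within `[0, b], continuous f} -> {within `[0, b], continuous g} ->
  (forall y, y \in `]0, b[%R -> `|df y| <= dg y) ->
  `|f b - f 0| <= g b - g 0.
Proof.
move=> b0 fD gD cf cg le_dfg.
have key (e : R) : `|e| = 1 -> e * (f b - f 0) <= g b - g 0.
  move=> e1; have [||c cb] := @MVT _ (fun y => g y - e * f y) (fun y => dg y - e * df y) _ _ b0.
  - by move=> y yb; apply: is_deriveB (gD y yb) (is_deriveZ e (fD y yb)).
  - by move=> y; apply: cvgB; [exact: cg|apply: cvgM; [exact: cvg_cst|exact: cf]].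
  rewrite -subr_ge0 subr0 => E.
  rewrite (_ : _ - _ = (dg c - e * df c) * b); last by rewrite -E; ring.
  rewrite mulr_ge0 ?(ltW b0)// subr_ge0 (le_trans _ (le_dfg c cb))//.
  by rewrite (le_trans (ler_norm _))// normrM e1 mul1r.
rewrite ler_norml lerNl -mulN1r -[X in _ && (X <= _)]mul1r.
by rewrite !key ?normrN ?normr1.
Qed.

(** With [E] the primitive of [e], the function [(eps + c E) exp (- c s)] is nonincreasing. The
    bound is asked at positive times only, where the Volterra equation is available. *)
Lemma gronwall (R : realType) (e : R -> R) (eps c t : R) : 0 < t -> 0 <= c ->
  (forall s, s \in `[0, t]%R -> {for s, continuous e}) ->
  (forall s, s \in `]0, t]%R ->
    e s <= eps + c * \int[lebesgue_measure]_(y in `[0, s]) e y) ->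
  e t <= eps * expR (c * t).
Proof.
move=> t0 c0 ce ele; pose E s := \int[lebesgue_measure]_(y in `[0, s]) e y.
have t_in : t \in `]0, t]%R by rewrite in_itv/= t0/=.
apply: le_trans (ele t t_in) _; rewrite -ler_pdivrMr ?expR_gt0// -expRN.
pose psi s := (eps + c * E s) * expR (- (c * s)).
pose dpsi s := c * (e s - (eps + c * E s)) * expR (- (c * s)).
have dexp (s : R) : is_derive s (1 : R) (fun s : R => expR (- (c * s))) (- c * expR (- (c * s))).
  by apply: is_derive_eq; rewrite /GRing.scale/=; ring.
have psi0 : psi 0 = eps.
  by rewrite /psi /E set_itv1 Rintegral_set1 mulr0 oppr0 expR0 mulr1 addr0.
rewrite -[leRHS]psi0 -[leLHS]/(psi t) -subr_le0.
have [||x xt ->] := @MVT _ psi dpsi _ _ t0.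
- move=> s st; have dE : is_derive s 1 E (e s) := primitive_derive st ce.
  have dl := is_deriveD (is_derive_cst eps s 1) (is_deriveZ c dE).
  apply: (is_derive_eq (is_derive1M dl (dexp s))).
  rewrite (_ : (cst eps + c \*: E) s = eps + c * E s)// /dpsi /GRing.scale/=.
  by ring.
- move=> s; apply: cvgM.
    apply: cvgD; first exact: cvg_cst.
    by apply: cvgM; [exact: cvg_cst|exact: (primitive_continuous t0 ce)].
  apply: continuous_subspaceT => {}s; apply: differentiable_continuous.
  by apply/derivable1_diffP; case: (dexp s).
rewrite subr0 mulr_le0_ge0 ?(ltW t0)// /dpsi mulr_le0_ge0 ?expR_ge0//.
rewrite mulr_ge0_le0// subr_le0; apply: ele.
by move: xt; rewrite !in_itv/= => /andP[-> /ltW].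
Qed.

(** The Beta integral, kept as a primitive so that it can serve in a comparison of derivatives. The
    induction on [i] is integration by parts. *)
Lemma beta_primitive (R : realType) (lambda s : R) (i m : nat) :
  exists2 H : R -> R,
    forall y : R, is_derive y 1 H
      (lambda * ((lambda * y) ^+ m / m`!%:R * ((lambda * (s - y)) ^+ i / i`!%:R)))
  & H s - H 0 = (lambda * s) ^+ (m + i).+1 / (m + i).+1`!%:R.
Proof.
have f0 n : n`!%:R != 0 :> R by rewrite pnatr_eq0 -lt0n fact_gt0.
pose mon n (y : R) := (lambda * y) ^+ n / n`!%:R.
have dmon n (y : R) : is_derive y (1 : R) (mon n.+1) (lambda * mon n y).
  have dl : is_derive y (1 : R) (fun y => lambda * y) lambda.
    by apply: is_derive_eq; rewrite /GRing.scale/= mulr1.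
  apply: (is_derive_eq (is_derive1M (is_derive1X n.+1 dl) (is_derive_cst ((n.+1)`!%:R^-1 : R) y 1))).
  rewrite /mon factS natrM mulr0 addr0 -[n.+1.-1]/n.
  have n0 : n.+1%:R != 0 :> R by rewrite pnatr_eq0.
  move: (f0 n) n0; move: (n`!%:R) (n.+1%:R : R) (_ ^+ n) => a b z a0 b0. rewrite /cst/=.
  by field; rewrite a0 b0.
have mon0 n : mon n.+1 0 = 0 by rewrite /mon mulr0 expr0n/= mul0r.
elim: i m => [|i IH] m.
  exists (mon m.+1) => [y|]; last by rewrite mon0 subr0 /mon addn0.
  by apply: (is_derive_eq (dmon m y)); rewrite expr0 fact0 divr1 mulr1.
have [H dH HE] := IH m.+1.
have dmons n (y : R) : is_derive y (1 : R) (fun y => mon n.+1 (s - y)) (- (lambda * mon n (s - y))).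
  have ds : is_derive y (1 : R) (fun y => s - y) (- 1).
    by apply: is_derive_eq; rewrite add0r mulrN1.
  have := @is_derive1_comp _ (mon n.+1) (fun y => s - y) _ _ _ (dmon n (s - y)) ds.
  by rewrite mulrN1.
exists (fun y => mon m.+1 y * mon i.+1 (s - y) + H y) => [y|].
  apply: (is_derive_eq (is_deriveD (is_derive1M (dmon m y) (dmons i y)) (dH y))).
  by rewrite /mon; ring.
by rewrite subrr !mon0 mulr0 mul0r !add0r HE addSn addnS.
Qed.

(** Multiplied by [(1 + u) ^ 2], the partial sum is [1] minus an explicit multiple of [(- u) ^ M];
    this exact remainder gives a bound for every [u >= 0], beyond the disc of convergence too. *)
Lemma inv_sqr_taylor (R : realType) (u : R) (M : nat) : 0 <= u ->
  `|(1 + u) ^- 2 - \sum_(i < M) i.+1%:R * (- u) ^+ i| <= M.+1%:R * u ^+ M.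
Proof.
move=> u0; have u1 : 0 < 1 + u by rewrite ltr_pwDl.
have E : (1 + u) ^+ 2 * \sum_(i < M) i.+1%:R * (- u) ^+ i =
    1 - (- u) ^+ M * (M.+1%:R + M%:R * u).
  elim: M => [|M IH]; first by rewrite big_ord0 expr0 mulr0 mul0r addr0 mulr1 subrr.
  by rewrite big_ord_recr/= mulrDr IH (exprS (- u) M) -!natr1; ring.
have -> : (1 + u) ^- 2 - \sum_(i < M) i.+1%:R * (- u) ^+ i =
    (- u) ^+ M * ((M.+1%:R + M%:R * u) / (1 + u) ^+ 2).
  have -> : \sum_(i < M) i.+1%:R * (- u) ^+ i =
      (1 - (- u) ^+ M * (M.+1%:R + M%:R * u)) / (1 + u) ^+ 2.
    by rewrite -E mulrAC divff ?mul1r// expf_neq0// lt0r_neq0.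
  by field; exact: lt0r_neq0.
have n0 : 0 <= M%:R :> R by [].
rewrite normrM normrX normrN (ger0_norm u0) mulrC ler_wpM2r ?exprn_ge0//.
rewrite ger0_norm; last by rewrite divr_ge0 ?sqr_ge0// addr_ge0 ?mulr_ge0.
rewrite ler_pdivrMr ?exprn_gt0// -natr1.
move: (M%:R : R) n0 => n n0; nra.
Qed.

Lemma kernel_continuous (R : realType) (lambda s : R) (w : R -> R) (y : R) :
  0 < lambda -> y <= s -> {for y, continuous w} ->
  {for y, continuous (fun y => w y / (1 + lambda * (s - y)) ^+ 2)}.
Proof.
move=> l0 ys cw; apply: cvgM => //; apply: cvgV.
  rewrite expf_neq0// lt0r_neq0// ltr_pwDl// mulr_ge0 ?subr_ge0//; exact: ltW.
apply: (@cvg_comp _ _ _ (fun y => 1 + lambda * (s - y)) (fun z => z ^+ 2)); last exact: exprn_continuous.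
apply: cvgD; first exact: cvg_cst.
by apply: cvgM; [exact: cvg_cst|apply: cvgB; [exact: cvg_cst|exact: cvg_id]].
Qed.

Lemma monomial_continuous (R : realType) (lambda : R) (m : nat) :
  continuous (fun y : R => (- (lambda * y)) ^+ m / m`!%:R).
Proof.
move=> y; apply: cvgM; last exact: cvg_cst.
apply: (@cvg_comp _ _ _ (fun y => - (lambda * y)) (fun z => z ^+ m)); last exact: exprn_continuous.
by apply: cvgN; apply: cvgM; [exact: cvg_cst|exact: cvg_id].
Qed.

(** The Taylor expansion of the kernel is integrated term by term against the monomial. The
    coefficient [j.+1] times the [j!] that normalizes the Beta integral makes [j.+1!], the factorial
    of the recurrence. *)
Lemma kernel_monomial (R : realType) (lambda s : R) (m M : nat) : 0 < lambda -> 0 < s ->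
  `|lambda * \int[lebesgue_measure]_(y in `[0, s])
       ((- (lambda * y)) ^+ m / m`!%:R / (1 + lambda * (s - y)) ^+ 2)
    + \sum_(j < M) j.+1`!%:R * ((- (lambda * s)) ^+ (m + j).+1 / (m + j).+1`!%:R)|
  <= M.+1`!%:R * ((lambda * s) ^+ (m + M).+1 / (m + M).+1`!%:R).
Proof.
move=> l0 s0.
have f0 n : n`!%:R != 0 :> R by rewrite pnatr_eq0 -lt0n fact_gt0.
pose K y := (- (lambda * y)) ^+ m / m`!%:R / (1 + lambda * (s - y)) ^+ 2.
have /choice[H HP] := fun i => let: ex_intro2 H h1 h2 := beta_primitive lambda s i m in
  ex_intro (fun H => _ /\ _) H (conj h1 h2).
have dH i y := (HP i).1 y; have HE i := (HP i).2.
have cH i : continuous (H i).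
  move=> y; apply: differentiable_continuous; apply/derivable1_diffP.
  by case: (dH i y).
have cK y : y \in `[0, s]%R -> {for y, continuous K}.
  rewrite in_itv/= => /andP[_ ys].
  by apply: kernel_continuous => //; exact: monomial_continuous.
pose I z := \int[lebesgue_measure]_(y in `[0, z]) K y.
pose w j : R := j.+1`!%:R * (- 1) ^+ (m + j).
pose f y := lambda * I y - \sum_(j < M) w j * H j y.
pose g y := M.+1`!%:R * H M y.
have cI : {within `[0, s], continuous I} := primitive_continuous s0 cK.
have cf : {within `[0, s], continuous f}.
  have cS : {within `[0, s], continuous (fun y => \sum_(j < M) w j * H j y)}.
    apply: continuous_subspaceT => y; apply: cvg_big => [|j _]; first exact: add_continuous.
    by apply: cvgM; [exact: cvg_cst|exact: cH].
  by move=> y; apply: cvgB; [apply: cvgM; [exact: cvg_cst|exact: cI]|exact: cS].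
have cg : {within `[0, s], continuous g}.
  by apply: continuous_subspaceT => y; apply: cvgM; [exact: cvg_cst|exact: cH].
pose dH' j y := lambda * ((lambda * y) ^+ m / m`!%:R * ((lambda * (s - y)) ^+ j / j`!%:R)).
have df y : y \in `]0, s[%R ->
    is_derive y 1 f (lambda * K y - \sum_(j < M) w j * dH' j y).
  move=> ys; have dI : is_derive y 1 I (K y) := primitive_derive ys cK.
  have dS := @is_derive1_sum _ M (fun j y => w j * H j y) (fun j => w j * dH' j y) y
    (fun j => is_deriveZ (w j) (dH j y)).
  exact: is_deriveB (is_deriveZ lambda dI) dS.
have dg y : y \in `]0, s[%R -> is_derive y 1 g (M.+1`!%:R * dH' M y).
  by move=> ys; apply: (@is_deriveZ _ _ _ (H M) (M.+1`!%:R : R) y 1 _ (dH M y)).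
have := derive_dominated s0 df dg cf cg.
have -> : g s - g 0 = M.+1`!%:R * ((lambda * s) ^+ (m + M).+1 / (m + M).+1`!%:R).
  by rewrite /g -mulrBr HE.
have -> : f s - f 0 = lambda * I s + \sum_(j < M)
    j.+1`!%:R * ((- (lambda * s)) ^+ (m + j).+1 / (m + j).+1`!%:R).
  rewrite /f /I set_itv1 Rintegral_set1 mulr0 sub0r opprK -addrA; congr (_ + _).
  rewrite addrC -sumrB; apply: eq_bigr => j _.
  rewrite -mulrBr -opprB HE /w [(- (lambda * s)) ^+ _]exprNn (exprS (- 1)); ring.
apply => y; rewrite in_itv/= => /andP[y0 ys].
have u0 : 0 <= lambda * (s - y) by rewrite mulr_ge0 ?subr_ge0// ltW.
have p0 : 0 <= lambda * ((lambda * y) ^+ m / m`!%:R).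
  by rewrite mulr_ge0 ?divr_ge0 ?exprn_ge0 ?mulr_ge0// ltW.
have -> : lambda * K y - \sum_(j < M) w j * dH' j y = (- 1) ^+ m * (lambda * ((lambda * y) ^+ m / m`!%:R))
    * ((1 + lambda * (s - y)) ^- 2 - \sum_(i < M) i.+1%:R * (- (lambda * (s - y))) ^+ i).
  rewrite [RHS]mulrBr /K [(- (lambda * y)) ^+ _]exprNn; congr (_ - _); first by ring.
  rewrite mulr_sumr; apply: eq_bigr => j _.
  rewrite /w /dH' factS natrM exprD [(- (lambda * _)) ^+ _]exprNn.
  by field; rewrite !f0.
rewrite normrM normrM normrX normrN1 expr1n mul1r (ger0_norm p0).
apply: le_trans (ler_wpM2l p0 (inv_sqr_taylor M u0)) _.
rewrite le_eqVlt; apply/orP; left; apply/eqP.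
by rewrite /dH' factS natrM; field; rewrite !f0.
Qed.

Lemma sum_shift (V : nmodType) (F : nat -> V) (m M : nat) :
  \sum_(j < M) F (m + j).+1 = \sum_(n < (m + M).+1 | (m < n)%N) F n.
Proof.
elim: M => [|M IH].
  rewrite big_ord0 addn0 big1// => -[n nm] /=.
  by rewrite ltnNge -ltnS nm.
rewrite big_ord_recr/= IH addnS [in RHS]big_mkcond [in RHS]big_ord_recr/=.
by rewrite -big_mkcond/= ltnS leq_addr.
Qed.

Lemma Rintegral_lincomb (R : realType) (b : R) (n : nat) (c : nat -> R) (f : nat -> R -> R) :
  (forall k x, x \in `[0, b]%R -> {for x, continuous (f k)}) ->
  \int[lebesgue_measure]_(y in `[0, b]) (\sum_(k < n) f k y * c k) =
  \sum_(k < n) \int[lebesgue_measure]_(y in `[0, b]) f k y * c k.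
Proof.
move=> cf.
have cfc k x : x \in `[0, b]%R -> {for x, continuous (fun y => f k y * c k)}.
  by move=> xb; apply: cvgM; [exact: cf|exact: cvg_cst].
elim: n => [|n IH].
  under eq_Rintegral do rewrite big_ord0.
  by rewrite Rintegral_cst// mul0r big_ord0.
under eq_Rintegral do rewrite big_ord_recr/=.
rewrite RintegralD//; last 2 first.
- apply: continuous_integrable => x xb.
  by apply: cvg_big => [|k _]; [exact: add_continuous|exact: cfc].
- by apply: continuous_integrable => x; exact: cfc.
by rewrite IH big_ord_recr/= RintegralZr//; apply: continuous_integrable => x; exact: cf.
Qed.

Lemma volterra_residual (R : realType) (lambda s : R) (d : nat) (a : nat -> nat) (N : nat) :
  0 < lambda -> 0 < s ->
  (forall n, a n = n`! + d * \sum_(m < n) a m * (n - m)`!)%N ->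
  `|1 / (1 + lambda * s)
    - \sum_(n < N.+1) (- (lambda * s)) ^+ n / n`!%:R * (a n)%:R
    - lambda * d%:R * \int[lebesgue_measure]_(y in `[0, s])
        ((\sum_(n < N.+1) (- (lambda * y)) ^+ n / n`!%:R * (a n)%:R)
           / (1 + lambda * (s - y)) ^+ 2)|
  <= (a N.+1)%:R / N.+1`!%:R * (lambda * s) ^+ N.+1.
Proof.
move=> l0 s0 aE.
have f0 n : n`!%:R != 0 :> R by rewrite pnatr_eq0 -lt0n fact_gt0.
have x0 : 0 < lambda * s by rewrite mulr_gt0.
set x := lambda * s in x0 *.
pose K m (y : R) := (- (lambda * y)) ^+ m / m`!%:R / (1 + lambda * (s - y)) ^+ 2.
pose J m := \int[lebesgue_measure]_(y in `[0, s]) K m y.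
pose q n : R := (- x) ^+ n / n`!%:R.
(* [- P m] is the part of degree at most [N] in the expansion of [lambda * J m] in powers of [x]. *)
pose P m : R := \sum_(n < N.+1 | (m < n)%N) (n - m)`!%:R * q n.
have -> : \int[lebesgue_measure]_(y in `[0, s])
    ((\sum_(n < N.+1) (- (lambda * y)) ^+ n / n`!%:R * (a n)%:R)
       / (1 + lambda * (s - y)) ^+ 2) = \sum_(m < N.+1) J m * (a m)%:R.
  rewrite -(@Rintegral_lincomb R s N.+1 (fun m => (a m)%:R) K); last first.
    move=> k y; rewrite in_itv/= => /andP[_ ys].
    by apply: kernel_continuous => //; exact: monomial_continuous.
  apply: eq_Rintegral => y _; rewrite mulr_suml; apply: eq_bigr => m _.
  by rewrite /K mulrAC.
have JP (m : 'I_N.+1) : `|lambda * J m + P m| <= (N.+1 - m)`!%:R * (x ^+ N.+1 / N.+1`!%:R).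
  have mN : (m <= N)%N by rewrite -ltnS.
  have mNE : (m + (N - m) = N)%N by rewrite subnKC.
  have PE : P m = \sum_(j < N - m) j.+1`!%:R * q (m + j).+1.
    have := sum_shift (fun n => (n - m)`!%:R * q n) m (N - m); rewrite mNE /P => <-.
    by apply: eq_bigr => j _; rewrite subSn ?leq_addr// addKn.
  by have := kernel_monomial m (N - m) l0 s0; rewrite PE mNE -subSn.
have geo : 1 / (1 + x) = \sum_(n < N.+1) (- x) ^+ n + (- x) ^+ N.+1 / (1 + x).
  have x1 : 1 + x != 0 by rewrite lt0r_neq0// addr_gt0.
  have := subrX1 (- x) N.+1; set S := \sum_(i < _) _ => E.
  apply: (mulIf x1); rewrite mulrDl !divfK//.
  have -> : S * (1 + x) = - ((- x - 1) * S) by ring.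
  by rewrite -E; ring.
have aq : \sum_(n < N.+1) (- x) ^+ n / n`!%:R * (a n)%:R =
    \sum_(n < N.+1) (- x) ^+ n + d%:R * \sum_(m < N.+1) P m * (a m)%:R.
  rewrite (eq_bigr (fun n : 'I_N.+1 => (- x) ^+ n + d%:R *
      \sum_(m < N.+1 | (m < n)%N) (a m)%:R * ((n - m)`!%:R * q n))); last first.
    move=> n _; rewrite [in LHS]aE natrD natrM natr_sum mulrDr divfK//; congr (_ + _).
    rewrite mulrCA; congr (_ * _).
    rewrite (big_ord_widen N.+1 (fun m => (a m * (n - m)`!)%:R))//; last exact: ltnW.
    by rewrite mulr_sumr; apply: eq_bigr => m _; rewrite natrM -/(q n); ring.
  rewrite big_split/= -mulr_sumr; congr (_ + _ * _).
  rewrite (exchange_big_dep xpredT)//=; apply: eq_bigr => m _.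
  by rewrite mulr_suml; apply: eq_bigr => n _; rewrite mulrC.
rewrite geo aq.
have -> : \sum_(n < N.+1) (- x) ^+ n + (- x) ^+ N.+1 / (1 + x)
    - (\sum_(n < N.+1) (- x) ^+ n + d%:R * (\sum_(m < N.+1) P m * (a m)%:R))
    - lambda * d%:R * (\sum_(m < N.+1) J m * (a m)%:R) =
    (- x) ^+ N.+1 / (1 + x) - d%:R * \sum_(m < N.+1) (lambda * J m + P m) * (a m)%:R.
  have -> : \sum_(m < N.+1) (lambda * J m + P m) * (a m)%:R =
      lambda * (\sum_(m < N.+1) J m * (a m)%:R) + \sum_(m < N.+1) P m * (a m)%:R.
    by rewrite mulr_sumr -big_split/=; apply: eq_bigr => m _; ring.
  by ring.
apply: le_trans (ler_normB _ _) _.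
(* The recurrence at [N.+1]: [N.+1!] matches the remainder of the geometric series, and the [m]-th
   term that of the kernel against degree [m]. *)
have -> : (a N.+1)%:R / N.+1`!%:R * x ^+ N.+1 = x ^+ N.+1 +
    d%:R * \sum_(m < N.+1) (N.+1 - m)`!%:R * (x ^+ N.+1 / N.+1`!%:R) * (a m)%:R.
  rewrite aE natrD natrM natr_sum !mulrDl divff// mul1r; congr (_ + _).
  rewrite -!mulrA; congr (_ * _); rewrite mulr_suml; apply: eq_bigr => m _.
  by rewrite natrM; ring.
apply: lerD.
  rewrite normrM normrX normrN normfV !gtr0_norm ?addr_gt0//.
  by rewrite ler_piMr ?exprn_ge0 ?(ltW x0)// invf_le1 ?addr_gt0// lerDl ltW.
rewrite normrM ger0_norm// ler_wpM2l//.
apply: le_trans (ler_norm_sum _ _ _) _; apply: ler_sum => m _.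
by rewrite normrM (@ger0_norm _ (a m)%:R)// ler_wpM2r.
Qed.

Lemma volterra_series (R : realType) (lambda t : R) (d : nat) (a : nat -> nat) (v : R -> R) :
  0 < lambda -> 0 < t -> lambda * t < 1 -> continuous v ->
  (forall s, 0 < s -> s <= t ->
    v s = 1 / (1 + lambda * s) - lambda * d%:R *
      \int[lebesgue_measure]_(y in `[0, s]) (v y / (1 + lambda * (s - y)) ^+ 2)) ->
  (forall n, a n = n`! + d * \sum_(m < n) a m * (n - m)`!)%N ->
  (fun N => \sum_(n < N.+1) (- (lambda * t)) ^+ n / n`!%:R * (a n)%:R) @ \oo --> v t.
Proof.
move=> l0 t0 lt1 cv vE aE; have [C aC] := fact_conv_bounded aE.
pose f N (y : R) := \sum_(n < N.+1) (- (lambda * y)) ^+ n / n`!%:R * (a n)%:R.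
have cf N : continuous (f N).
  move=> y; apply: cvg_big => [|n _]; first exact: add_continuous.
  by apply: cvgM; [exact: monomial_continuous|exact: cvg_cst].
pose e N y := `|v y - f N y|.
have cve N : continuous (fun y => v y - f N y).
  by move=> y; apply: cvgB; [exact: cv|exact: cf].
have ce N : continuous (e N).
  by move=> y; apply: cvg_norm; exact: cve.
have x0 : 0 < lambda * t by rewrite mulr_gt0.
pose bnd N := C%:R * (lambda * t) ^+ N.+1 * expR (lambda * d%:R * t).
have ebnd N : e N t <= bnd N.
  apply: gronwall => // [|s _|s]; [by rewrite mulr_ge0// ltW|exact: ce|].
  rewrite in_itv/= => /andP[s0 st].
  have ck (w : R -> R) : continuous w ->
      lebesgue_measure.-integrable `[0, s] (EFin \o (fun y => w y / (1 + lambda * (s - y)) ^+ 2)).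
    move=> cw; apply: continuous_integrable => y; rewrite in_itv/= => /andP[_ ys].
    by apply: kernel_continuous => //; exact: cw.
  have -> : e N s = `|(1 / (1 + lambda * s) - f N s
      - lambda * d%:R * \int[lebesgue_measure]_(y in `[0, s]) (f N y / (1 + lambda * (s - y)) ^+ 2))
      - lambda * d%:R * \int[lebesgue_measure]_(y in `[0, s]) ((v y - f N y) / (1 + lambda * (s - y)) ^+ 2)|.
    have -> : \int[lebesgue_measure]_(y in `[0, s]) ((v y - f N y) / (1 + lambda * (s - y)) ^+ 2)
        = \int[lebesgue_measure]_(y in `[0, s]) (v y / (1 + lambda * (s - y)) ^+ 2)
        - \int[lebesgue_measure]_(y in `[0, s]) (f N y / (1 + lambda * (s - y)) ^+ 2).
      rewrite -RintegralB//; [|exact: ck..].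
      by apply: eq_Rintegral => y _; rewrite mulrBl.
    by rewrite /e vE//; congr `|_|; ring.
  (* The residual is at most [C (lambda t) ^ N.+1], uniformly in [s <= t]; in the other term the
     kernel is at most 1. *)
  apply: le_trans (ler_normB _ _) _; apply: lerD.
    apply: le_trans (volterra_residual N l0 s0 aE) _; apply: ler_pM.
    - by rewrite divr_ge0.
    - by rewrite exprn_ge0// mulr_ge0// ltW.
    - by rewrite ler_pdivrMr ?ltr0n ?fact_gt0// -natrM ler_nat.
    - by rewrite lerXn2r ?nnegrE ?mulr_ge0 ?(ltW l0) ?(ltW s0) ?(ltW t0)// ler_pM2l.
  rewrite normrM ger0_norm; last by rewrite mulr_ge0// ltW.
  rewrite ler_wpM2l//; first by rewrite mulr_ge0// ltW.
  apply: le_trans (le_normr_Rintegral _ (ck _ (cve N))) _ => //.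
  apply: le_Rintegral => //.
  - apply: (@continuous_integrable _ (fun y => `|(v y - f N y) / (1 + lambda * (s - y)) ^+ 2|)).
    move=> y; rewrite in_itv/= => /andP[_ ys]; apply: cvg_norm.
    by apply: (kernel_continuous l0 ys); exact: cve.
  - by apply: continuous_integrable => y _; exact: ce.
  - move=> y; rewrite /= in_itv/= => /andP[_ ys].
    have u1 : 1 <= 1 + lambda * (s - y) by rewrite lerDl mulr_ge0 ?subr_ge0// ltW.
    rewrite /e normrM ler_piMr// normfV invf_le1 ?normr_gt0 ?expf_neq0 ?lt0r_neq0 ?(lt_le_trans ltr01)//.
    by rewrite normrX ger0_norm ?(le_trans ler01)// exprn_ege1.
have bnd0 : bnd N @[N --> \oo] --> (0 : R).
  have : (C%:R * (lambda * t) * expR (lambda * d%:R * t)) * (lambda * t) ^+ N @[N --> \oo] --> (0 : R).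
    by apply: cvg_geometric; rewrite gtr0_norm.
  by under eq_fun do rewrite mulrAC -[_ * _ ^+ _]mulrA -exprS.
apply/subr_cvg0/norm_cvg0P; apply: (squeeze_cvgr _ (cvg_cst 0) bnd0).
by apply: nearW => N; rewrite normr_ge0/= distrC; exact: ebnd.
Qed.

(** * The emptiness probability *)

Lemma NJ_state_subproof (d k : nat) (j : 'I_d) : in_state d (ident0 k j.+1).
Proof. by case: k => [|k]; rewrite /ident0 /in_state //= ltn_ord. Qed.

(** Level [0] is the empty state for every label, so the downward jump from level 1 needs no
    separate case. *)
Definition NJ_state (d k : nat) (j : 'I_d) : state d :=
  exist (fun x => in_state d x) (ident0 k j.+1) (NJ_state_subproof k j).

Lemma NJ_state0 d (j : 'I_d) : NJ_state 0 j = empty_state d.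
Proof. exact: val_inj. Qed.

Lemma NJ_stateS_inj d k : injective (@NJ_state d k.+1).
Proof. by move=> i j /(congr1 val)[] /val_inj. Qed.

Lemma NJ_stateP d (x : state d) :
  x = empty_state d \/ exists k j, x = NJ_state k.+1 (j : 'I_d).
Proof.
case: x => -[k j] /= kj; case/orP: (kj) => [/eqP[k0 j0]|/andP[/= k0 /andP[j0 jd]]].
  by left; apply: val_inj; rewrite /= k0 j0.
case: k j k0 j0 jd kj => [//|k] [//|j] _ _ jd kj; right.
by exists k, (Ordinal jd); apply: val_inj.
Qed.

Section NJ_chain.
Context (R : realType) (d : nat) (lambda : R) (p : R -> state d -> state d -> R).
Hypothesis lambda_gt0 : 0 < lambda.
Let q := @NJ_rate R d lambda lambda lambda.
Hypothesis tf : transition_function q p.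

Lemma NJ_rate_ge0 x y : 0 <= q x y.
Proof.
rewrite /q /NJ_rate; case: (val x) => k j; have l0 := ltW lambda_gt0.
by do !case: ifP => _ //; rewrite ?addr_ge0 ?mulr_ge0.
Qed.

(** [F0] and [F1] list the states reachable in one jump; the [d] elements of [F0] are the origin of
    the factor [d] at [0]. *)
Let F0 := [seq NJ_state 1 j | j <- enum 'I_d].
Let F1 k (j : 'I_d) := [:: NJ_state k.+2 j; NJ_state k j].

Lemma NJ_rate_empty y : y \notin F0 -> q (empty_state d) y = 0.
Proof.
rewrite /q /NJ_rate /=; case: eqP => // y1 /negP[]; apply/mapP.
have [yE|[k [j yE]]] := NJ_stateP y; first by rewrite yE in y1.
by exists j; rewrite ?mem_enum// yE; move: y1; rewrite yE /= => -[->].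
Qed.

Lemma NJ_rate_pos k (j : 'I_d) y : y \notin F1 k j -> q (NJ_state k.+1 j) y = 0.
Proof.
rewrite !inE negb_or /q /NJ_rate -!val_eqE /= => /andP[/negPf y1 /negPf y2].
by rewrite y1 y2.
Qed.

Lemma NJ_continuous x z : continuous (fun t : R => p `|t| x z).
Proof.
have [->|[k [j ->]]] := NJ_stateP x.
- apply: (@transition_continuous _ _ _ _ tf _ F0).
  + by rewrite map_inj_uniq ?enum_uniq//; exact: NJ_stateS_inj.
  + by apply/mapP => -[j _ /(congr1 val)].
  + exact: NJ_rate_ge0.
  + by move=> y _; exact: NJ_rate_empty.
- apply: (@transition_continuous _ _ _ _ tf _ (F1 k j)).
  + by rewrite /= andbT inE -val_eqE /=; case: k => [|k] /=; rewrite ?xpair_eqE; lia.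
  + by rewrite !inE -!val_eqE /=; case: k => [|k] /=; rewrite ?xpair_eqE; lia.
  + exact: NJ_rate_ge0.
  + by move=> y _; exact: NJ_rate_pos.
Qed.

Lemma NJ_backward_empty z (t : R) : 0 < t ->
  is_derive t (1 : R) (fun t : R => p `|t| (empty_state d) z)
    (\sum_(j < d) lambda * (p t (NJ_state 1 j) z - p t (empty_state d) z)).
Proof.
move=> t0; have -> : \sum_(j < d) lambda * (p t (NJ_state 1 j) z - p t (empty_state d) z)
    = \sum_(y <- F0) q (empty_state d) y * (p t y z - p t (empty_state d) z).
  by rewrite big_map big_enum.
apply: (transition_backward tf) => //.
+ by rewrite map_inj_uniq ?enum_uniq//; exact: NJ_stateS_inj.
+ by apply/mapP => -[j _ /(congr1 val)].
+ exact: NJ_rate_ge0.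
+ by move=> y _; exact: NJ_rate_empty.
+ by move=> y; exact: NJ_continuous.
Qed.

Lemma NJ_backward_pos k (j : 'I_d) z (t : R) : 0 < t ->
  is_derive t (1 : R) (fun t : R => p `|t| (NJ_state k.+1 j) z)
    (lambda * (k.+2%:R * (p t (NJ_state k.+2 j) z - p t (NJ_state k.+1 j) z)
       + k.+1%:R * (p t (NJ_state k j) z - p t (NJ_state k.+1 j) z))).
Proof.
move=> t0.
have u1 : NJ_state k.+2 j != NJ_state k j.
  by rewrite -val_eqE /=; case: k => [|k] /=; rewrite ?xpair_eqE; lia.
have -> : lambda * (k.+2%:R * (p t (NJ_state k.+2 j) z - p t (NJ_state k.+1 j) z)
       + k.+1%:R * (p t (NJ_state k j) z - p t (NJ_state k.+1 j) z))
    = \sum_(y <- F1 k j) q (NJ_state k.+1 j) y * (p t y z - p t (NJ_state k.+1 j) z).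
  rewrite big_cons big_seq1 /q /NJ_rate /= eqxx -[k in LHS]/(k.+1.-1).
  rewrite -val_eqE eq_sym in u1; rewrite /= in u1.
  by rewrite (negPf u1) eqxx -!natr1; ring.
apply: (transition_backward tf) => //.
+ by rewrite /= andbT inE.
+ by rewrite !inE -!val_eqE /=; case: k {u1} => [|k] /=; rewrite ?xpair_eqE; lia.
+ exact: NJ_rate_ge0.
+ by move=> y _; exact: NJ_rate_pos.
+ by move=> y; exact: NJ_continuous.
Qed.
End NJ_chain.

Lemma NJ_volterra (R : realType) (d : nat) (lambda t : R) (p : R -> state d -> state d -> R) :
  (0 < d)%N -> 0 < lambda -> transition_function (@NJ_rate R d lambda lambda lambda) p ->
  0 < t ->
  p `|t| (empty_state d) (empty_state d) =
    1 / (1 + lambda * t) - lambda * (d%:R - 1) *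
    \int[lebesgue_measure]_(y in `[0, t])
      (p `|y| (empty_state d) (empty_state d) / (1 + lambda * (t - y)) ^+ 2).
Proof.
move=> d0 l0 tf t0; pose o := empty_state d.
have dR0 : d%:R != 0 :> R by rewrite pnatr_eq0 -lt0n.
(* All labels agree at level [0], so the average [v 0] is the emptiness probability itself, and the
   [d] exits combine into [lambda d (v 1 - v 0)]. *)
pose v k (s : R) := (\sum_(j < d) p `|s| (NJ_state k j) o) * d%:R^-1.
have v0E s : v 0%N s = p `|s| o o.
  rewrite /v; under eq_bigr do rewrite NJ_state0.
  by rewrite sumr_const card_ord -(mulr_natr (p `|s| o o)) mulfK.
have := @birth_death_volterra R lambda d%:R 1 t v l0; rewrite ltr0n => /(_ d0 t0) H.
have cv k : continuous (v k).
  move=> s; apply: cvgM; last exact: cvg_cst.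
  by apply: cvg_big => [|j _]; [exact: add_continuous|exact: NJ_continuous tf _ _ _].
have d0v (s : R) : 0 < s -> is_derive s (1 : R) (v 0%N) (lambda * d%:R * (v 1%N s - v 0%N s)).
  move=> s0; rewrite [X in is_derive _ _ X _](_ : _ = fun s => p `|s| o o); last exact/funext.
  apply: (is_derive_eq (NJ_backward_empty l0 tf o s0)).
  rewrite -mulr_sumr sumrB sumr_const card_ord -(mulr_natr (p s o o)) v0E /v (gtr0_norm s0).
  by field.
have dv k (s : R) : 0 < s -> is_derive s (1 : R) (v k.+1)
    (lambda * (k.+2%:R * (v k.+2 s - v k.+1 s) + k.+1%:R * (v k s - v k.+1 s))).
  move=> s0.
  pose u j (s : R) := p `|s| (NJ_state k.+1 j) o.
  have du j := NJ_backward_pos l0 tf k j o s0.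
  have vE : v k.+1 = d%:R^-1 \*: \sum_(j < d) u j.
    by apply/funext => y; rewrite /v mulrC /= fct_sumE.
  rewrite [X in is_derive _ _ X _]vE.
  apply: (is_derive_eq (is_deriveZ d%:R^-1 (is_derive_sum du))).
  rewrite /v (gtr0_norm s0) -mulr_sumr big_split/= -!mulr_sumr !sumrB.
  rewrite -[LHS]/(d%:R^-1 * _).
  by field.
have vB k s : 0 <= s -> `|v k s| <= 1.
  move=> s0; have p0 j := tf_ge0 tf (NJ_state k j) o (normr_ge0 s).
  rewrite /v normrM normfV (@ger0_norm _ d%:R)// ler_pdivrMr ?ltr0n// mul1r.
  rewrite ger0_norm ?sumr_ge0// -[leRHS](_ : \sum_(j < d) (1 : R) = _); last first.
    by rewrite sumr_const card_ord.
  by apply: ler_sum => j _; exact: transition_le1 tf (normr_ge0 s).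
have vt0 k : v k 0 = (k == 0%N)%:R.
  rewrite /v normr0.
  under eq_bigr do rewrite (tf_time0 tf).
  rewrite (eq_bigr (fun=> (k == 0%N)%:R)); last first.
    by move=> j _; rewrite -val_eqE /=; case: k.
  by rewrite sumr_const card_ord -(mulr_natr (k == 0%N)%:R) mulfK.
rewrite -v0E (H cv d0v dv vB vt0).
by congr (_ - _ * _); apply: eq_Rintegral => y _; rewrite v0E.
Qed.

Lemma emptiness_probE (R : realType) (dO : measure_display)
    (Omega : measurableType dO) (P : probability Omega R) (d : nat)
    (X : R -> Omega -> state d) (q : state d -> state d -> R)
    (p : R -> state d -> state d -> R) (t : R) :
  transition_function q p -> Markov_property P X p ->
  P [set w | X 0 w = empty_state d] = 1%E -> 0 <= t ->
  emptiness_prob P X t = p t (empty_state d) (empty_state d).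
Proof.
move=> tf MP X0; rewrite le_eqVlt => /predU1P[<-|t0].
  by rewrite /emptiness_prob /cond_prob setIid X0 divr1 (tf_time0 tf) eqxx.
rewrite /emptiness_prob /cond_prob X0 divr1.
(* Only the two times [0] and [t] are used. They must be strictly increasing, hence the separate
   treatment of [t = 0]. *)
have := MP 0%N (fun i => i%:R * t) (fun=> empty_state d).
rewrite /= mul0r lexx => /(_ isT) H.
have A1 : [set w | forall i, (i <= 1)%N -> X (i%:R * t) w = empty_state d] =
    [set w | X t w = empty_state d] `&` [set w | X 0 w = empty_state d].
  apply/seteqP; split => w /=.
    by move=> h; have := h 0%N isT; have := h 1%N isT; rewrite mul0r mul1r.
  by move=> [h1 h0] [|[|//]] _; rewrite ?mul0r ?mul1r.
have A0 : [set w | forall i, (i <= 0)%N -> X (i%:R * t) w = empty_state d] =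
    [set w | X 0 w = empty_state d].
  apply/seteqP; split => w /=; first by move=> /(_ 0%N isT); rewrite mul0r.
  by move=> h0 [|//] _; rewrite mul0r.
rewrite A1 A0 X0 mul1r subr0 mul1e in H; rewrite H//.
by move=> [|//] _; rewrite mul0r mul1r.
Qed.

Theorem proposition4p1 (R : realType) (d : nat) (alpha lambda mu : R)
    (dO : measure_display) (Omega : measurableType dO)
    (P : probability Omega R) (X : R -> Omega -> state d)
    (d_gt0 : (0 < d)%N) (lambda_gt0 : 0 < lambda)
    (alpha_lambda : alpha = lambda) (lambda_mu : lambda = mu)
    (X_CTMC : CTMC P (@NJ_rate R d alpha lambda mu) X)
    (X_init : P [set w | X 0 w = empty_state d] = 1%E) :
  forall t : R, 0 < t -> t < 1 / lambda ->
    emptiness_prob P X t =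
      1 / (1 + lambda * t)
      - lambda * (d%:R - 1)
        * \int[lebesgue_measure]_(y in `[0, t])
            (emptiness_prob P X y / (1 + lambda * (t - y)) ^+ 2)
    /\
    (fun m : nat =>
       1 + \sum_(1 <= n < m.+1)
             (- (lambda * t)) ^+ n / n`!%:R
             * \sum_(1 <= j < n.+1) (num_perm_components n j)%:R * d%:R ^+ j)
      @ \oo --> emptiness_prob P X t.
Proof.
move=> t t0 lt1; case: X_CTMC => _ [p tf MP].
move: tf; rewrite alpha_lambda -lambda_mu => tf.
pose v (s : R) := p `|s| (empty_state d) (empty_state d).
have vE s : 0 <= s -> emptiness_prob P X s = v s.
  by move=> s0; rewrite (emptiness_probE tf MP X_init s0) /v ger0_norm.
have volterra s : 0 < s -> v s = 1 / (1 + lambda * s) - lambda * (d%:R - 1) *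
    \int[lebesgue_measure]_(y in `[0, s]) (v y / (1 + lambda * (s - y)) ^+ 2).
  exact: NJ_volterra.
rewrite (vE t (ltW t0)); split.
  rewrite [LHS]volterra//; congr (_ - _ * _); apply: eq_Rintegral => y.
  by rewrite inE /= in_itv/= => /andP[y0 _]; rewrite vE.
have dE : d%:R - 1 = d.-1%:R :> R by rewrite -[in LHS](prednK d_gt0) -natr1 addrK.
have lt1' : lambda * t < 1 by rewrite mulrC -ltr_pdivlMr.
have wE n : weight d n = (n`! + d.-1 * \sum_(m < n) weight d m * (n - m)`!)%N.
  by have := weight_rec d.-1 n; rewrite prednK.
have cv : continuous v by exact: NJ_continuous lambda_gt0 tf _ _.
have := volterra_series lambda_gt0 t0 lt1' cv _ wE.
rewrite -dE => /(_ (fun s s0 _ => volterra s s0)); apply: near_cvg_eq.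
(* The term of index 0, equal to the weight of the empty permutation, is the leading [1] of the
   statement. *)
apply: nearW => m; rewrite big_ord_recl /= expr0 fact0 divr1 mul1r.
congr (_ + _); first by rewrite wE big_ord0 muln0 addn0.
rewrite big_add1 /= big_mkord; apply: eq_bigr => n _; congr (_ * _).
by rewrite /bump /= add1n -weightE// natr_sum; apply: eq_bigr => j _; rewrite natrM natrX.
Qed.
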